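(* Let $k$ be an algebraically closed field of characteristic zero, let $2\le n<d$ and $0\le\alpha_0\le\cdots\le\alpha_n<d$ be integers with $\mathrm{GCD}(\alpha_0,\ldots,\alpha_n,d)=1$, and let $e\in k$ be a primitive $d$th root of unity. Let $\Lambda\subset GL(n+1,k)$ be the cyclic group of order $d$ generated by $\mathrm{diag}(e^{\alpha_0},\ldots,e^{\alpha_n})$, and suppose that the abelian group $\overline\Lambda$ generated by $\mathrm{diag}(e^{\alpha_0},\ldots,e^{\alpha_n})$ and $\mathrm{diag}(e,\ldots,e)$ has order $d^2$. Let $\{m_1,\ldots,m_{\mu_d}\}$ be the set of all monomials of degree $d$ in $R=k[x_0,\ldots,x_n]$ which are invariants of $\Lambda$ and let $I_d\subset R$ be the monomial artinian ideal generated by them. If $\mu_d\le\binom{n+d-1}{n-1}$, then $I_d$ is a monomial $GT$-system.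
   Context: A diagonal matrix $\mathrm{diag}(c_0,\ldots,c_n)$ acts on $R$ by $x_i\mapsto c_i x_i$. Weak Lefschetz property: a homogeneous artinian ideal $I\subset R$ fails the WLP in degree $j_0$ if for every linear form $L\in R_1$ the multiplication map $\times L:(R/I)_{j_0}\to(R/I)_{j_0+1}$ does not have maximal rank. Togliatti system: an artinian ideal $I\subset R$ generated by $r\le\binom{n+d-1}{n-1}$ forms of degree $d$ which fails the WLP in degree $d-1$. Covering: a covering of a variety $X$ is a variety $Y$ with a finite morphism $f:Y\to X$; its group of deck transformations $\mathrm{Aut}(f)$ is the group of automorphisms of $Y$ commuting with $f$ (i.e. automorphisms $g$ with $f\circ g=f$). The covering is Galois with group $\mathrm{Aut}(f)$ if $\mathrm{Aut}(f)$ acts transitively on a fibre $f^{-1}(x)$ for some $x\in X$. $GT$-system: a Togliatti system $I\subset R$ generated by $r$ forms $F_1,\ldots,F_r$ of degree $d$ such that the morphism $\varphi_I:\mathbb{P}^n\to\mathbb{P}^{r-1}$ defined by $(F_1,\ldots,F_r)$ is a Galois covering (of its image $\varphi_I(\mathbb{P}^n)$) with cyclic group $\mathbb{Z}/d\mathbb{Z}$. It is called monomial if the ideal can be generated by monomials. *)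

(* Defs.v *)
From HB Require Import structures.
From mathcomp Require Import all_boot all_order all_algebra.
From mathcomp Require Import generic_quotient.
From mathcomp Require Import mpoly.
From mathcomp Require Import classical_sets.

Set Implicit Arguments.
Unset Strict Implicit.
Unset Printing Implicit Defensive.

Import GRing.Theory.

Local Open Scope classical_set_scope.
Local Open Scope ring_scope.
Local Open Scope quotient_scope.

(* [proj k m] is the projective space with [m] homogeneous coordinates, that is
   P^(m-1) over [k]: nonzero row vectors up to scaling. *)

Definition nzvec (k : fieldType) (m : nat) := {v : 'rV[k]_m | v != 0}.

(* Equality of the lines spanned by the two vectors. *)
Definition proportional (k : fieldType) (m : nat) (u v : nzvec k m) : bool :=
  (val u == val v)%MS.

Lemma proportional_refl (k : fieldType) (m : nat) :
  reflexive (@proportional k m).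
Proof. by move=> u; rewrite /proportional !submx_refl. Qed.

Lemma proportional_sym (k : fieldType) (m : nat) :
  ssrbool.symmetric (@proportional k m).
Proof. by move=> u v; rewrite /proportional andbC. Qed.

Lemma proportional_trans (k : fieldType) (m : nat) :
  transitive (@proportional k m).
Proof.
move=> v u w /andP[uv vu] /andP[vw wv]; rewrite /proportional.
by rewrite (submx_trans uv vw) (submx_trans wv vu).
Qed.

Canonical proportional_equiv (k : fieldType) (m : nat) :=
  EquivRel (@proportional k m) (@proportional_refl k m)
    (@proportional_sym k m) (@proportional_trans k m).

Definition proj (k : fieldType) (m : nat) :=
  {eq_quot (@proportional_equiv k m)}.

HB.instance Definition _ (k : fieldType) (m : nat) :=
  EqQuotient.on (proj k m).
HB.instance Definition _ (k : fieldType) (m : nat) := Choice.on (proj k m).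

(* [is_point v x] : x = [v_0 : ... : v_(m-1)]; in particular v is nonzero. *)
Definition is_point (k : fieldType) (m : nat) (v : 'rV[k]_m) (x : proj k m) :
    Prop :=
  exists v_neq0 : v != 0, x = \pi_(proj k m) (exist _ v v_neq0).

Definition coords (k : fieldType) (m : nat) (x : proj k m) : 'rV[k]_m :=
  val (repr x).

(* The value of [p] at the chosen representative [coords x].  It is only used
   for the vanishing of a form, for quotients of two forms of the same degree,
   and for tuples of forms of the same degree taken as homogeneous coordinates;
   these do not depend on the representative. *)
Definition pval (k : fieldType) (m : nat) (p : {mpoly k[m]}) (x : proj k m) : k :=
  p.@[fun i => coords x 0 i].

Definition zariski_closed (k : fieldType) (m : nat) (Z : set (proj k m)) : Prop :=
  exists S : set {mpoly k[m]},
    (forall p, S p -> exists e : nat, p \is e.-homog) /\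
    Z = [set x | forall p, S p -> pval p x = 0].

Definition zariski_open (k : fieldType) (m : nat) (U : set (proj k m)) : Prop :=
  zariski_closed (~` U).

Definition locally_closed (k : fieldType) (m : nat) (V : set (proj k m)) : Prop :=
  exists Z U, [/\ zariski_closed Z, zariski_open U & V = Z `&` U].

Definition irreducible (k : fieldType) (m : nat) (V : set (proj k m)) : Prop :=
  V !=set0 /\
  forall A B : set (proj k m), zariski_closed A -> zariski_closed B ->
    V `<=` A `|` B -> V `<=` A \/ V `<=` B.

Definition variety (k : fieldType) (m : nat) (V : set (proj k m)) : Prop :=
  locally_closed V /\ irreducible V.

Definition regular_on (k : fieldType) (m : nat) (V : set (proj k m))
    (h : proj k m -> k) : Prop :=
  forall x, V x ->
    exists (e : nat) (p q : {mpoly k[m]}) (U : set (proj k m)),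
      [/\ p \is e.-homog, q \is e.-homog, zariski_open U, U x &
          forall y, V y -> U y -> pval q y != 0 /\ h y = pval p y / pval q y].

(* Maps between locally closed sets are total functions between the ambient
   projective spaces of which only the restriction to the source matters. *)
Definition morphism (k : fieldType) (m p : nat) (V : set (proj k m))
    (W : set (proj k p)) (f : proj k m -> proj k p) : Prop :=
  (forall x, V x -> W (f x)) /\
  forall x, V x ->
    exists (e : nat) (G : 'I_p -> {mpoly k[m]}) (U : set (proj k m)),
      [/\ forall j, G j \is e.-homog, zariski_open U, U x &
          forall y, V y -> U y -> is_point (\row_j pval (G j) y) (f y)].

Definition isomorphic (k : fieldType) (m p : nat) (V : set (proj k m))
    (W : set (proj k p)) : Prop :=
  exists (f : proj k m -> proj k p) (g : proj k p -> proj k m),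
    [/\ morphism V W f, morphism W V g,
        forall x, V x -> g (f x) = x & forall y, W y -> f (g y) = y].

Definition affine_chart (k : fieldType) (m : nat) : set (proj k m.+1) :=
  [set x | coords x 0 ord0 != 0].

(* Isomorphic to a closed subset of an affine space A^m, where A^m is the
   complement of the hyperplane x_0 = 0 in P^m. *)
Definition affine (k : fieldType) (p : nat) (V : set (proj k p)) : Prop :=
  exists (m : nat) (Z : set (proj k m.+1)),
    zariski_closed Z /\ isomorphic V (Z `&` @affine_chart k m).

(* The last clause: the ring of regular functions on the preimage of V is a
   finitely generated module over that of V. *)
Definition finite_morphism (k : fieldType) (m p : nat) (Y : set (proj k m))
    (X : set (proj k p)) (f : proj k m -> proj k p) : Prop :=
  morphism Y X f /\
  forall x, X x -> exists U : set (proj k p),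
    let V := X `&` U in
    let W := Y `&` f @^-1` V in
    [/\ zariski_open U, U x, affine V, affine W &
        exists (s : nat) (b : 'I_s -> proj k m -> k),
          (forall i, regular_on W (b i)) /\
          forall h, regular_on W h ->
            exists c : 'I_s -> proj k p -> k,
              (forall i, regular_on V (c i)) /\
              forall y, W y -> h y = \sum_(i < s) c i (f y) * b i y].

Definition covering (k : fieldType) (m p : nat) (Y : set (proj k m))
    (X : set (proj k p)) (f : proj k m -> proj k p) : Prop :=
  [/\ variety Y, variety X & finite_morphism Y X f].

Definition automorphism (k : fieldType) (m : nat) (Y : set (proj k m))
    (g : proj k m -> proj k m) : Prop :=
  morphism Y Y g /\
  exists g' : proj k m -> proj k m,
    [/\ morphism Y Y g', forall y, Y y -> g' (g y) = y &
        forall y, Y y -> g (g' y) = y].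

(* The group Aut(f); its elements are taken up to equality on [Y]. *)
Definition deck (k : fieldType) (m p : nat) (Y : set (proj k m))
    (f : proj k m -> proj k p) : set (proj k m -> proj k m) :=
  [set g | automorphism Y g /\ forall y, Y y -> f (g y) = f y].

Definition galois_covering (k : fieldType) (m p : nat) (Y : set (proj k m))
    (X : set (proj k p)) (f : proj k m -> proj k p) : Prop :=
  covering Y X f /\
  exists2 x, X x &
    forall y z, Y y -> Y z -> f y = x -> f z = x ->
      exists2 g, deck Y f g & g y = z.

(* Aut(f) is isomorphic to Z/dZ: [psi] is a surjective group morphism from Z
   to Aut(f) with kernel dZ. *)
Definition deck_group_Zmod (k : fieldType) (m p : nat) (Y : set (proj k m))
    (f : proj k m -> proj k p) (d : nat) : Prop :=
  exists psi : int -> proj k m -> proj k m,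
    [/\ forall i, deck Y f (psi i),
        forall i j y, Y y -> psi (i + j) y = psi i (psi j y),
        forall g, deck Y f g -> exists i, forall y, Y y -> g y = psi i y &
        forall i, (forall y, Y y -> psi i y = y) <-> (d %| i)%Z].

Definition is_ideal (A : comNzRingType) (I : set A) : Prop :=
  [/\ I 0, forall p q, I p -> I q -> I (p + q) & forall c p, I p -> I (c * p)].

Definition ideal_gen (A : comNzRingType) (r : nat) (F : 'I_r -> A) : set A :=
  [set p | exists c : 'I_r -> A, p = \sum_(i < r) c i * F i].

(* The quotient by [I] is an artinian ring: descending chain condition on the
   ideals containing [I]. *)
Definition artinian (A : comNzRingType) (I : set A) : Prop :=
  forall J : nat -> set A,
    (forall i, is_ideal (J i)) -> (forall i, I `<=` J i) ->
    (forall i, J i.+1 `<=` J i) ->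
    exists i0, forall i, (i0 <= i)%N -> J i = J i0.

(* Multiplication by [L] from degree [j] to degree [j + 1] of the quotient by
   [I] has maximal rank, that is, is injective or surjective. *)
Definition mul_max_rank (k : fieldType) (m : nat) (I : set {mpoly k[m]})
    (L : {mpoly k[m]}) (j : nat) : Prop :=
  (forall p, p \is j.-homog -> I (L * p) -> I p) \/
  (forall q, q \is j.+1.-homog -> exists2 p, p \is j.-homog & I (q - L * p)).

Definition fails_WLP (k : fieldType) (m : nat) (I : set {mpoly k[m]}) (j : nat) :
    Prop :=
  forall L : {mpoly k[m]}, L \is 1.-homog -> ~ mul_max_rank I L j.

Definition togliatti (k : fieldType) (n d r : nat) (F : 'I_r -> {mpoly k[n.+1]}) :
    Prop :=
  [/\ forall i, F i \is d.-homog,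
      (r <= 'C(n + d - 1, n - 1))%N,
      artinian (ideal_gen F) &
      fails_WLP (ideal_gen F) (d - 1)].

Definition defined_by (k : fieldType) (n r : nat) (F : 'I_r -> {mpoly k[n.+1]})
    (phi : proj k n.+1 -> proj k r) : Prop :=
  forall x, is_point (\row_i pval (F i) x) (phi x).

Definition GT_system (k : fieldType) (n d : nat) (I : set {mpoly k[n.+1]}) : Prop :=
  exists (r : nat) (F : 'I_r -> {mpoly k[n.+1]}),
    [/\ I = ideal_gen F, togliatti d F &
        exists phi : proj k n.+1 -> proj k r,
          [/\ defined_by F phi,
              galois_covering setT (range phi) phi &
              deck_group_Zmod setT phi d]].

Definition monomial_ideal (k : fieldType) (m : nat) (I : set {mpoly k[m]}) : Prop :=
  exists (r : nat) (a : 'I_r -> 'X_{1..m}),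
    I = ideal_gen (fun i => 'X_[a i] : {mpoly k[m]}).

Definition monomial_GT_system (k : fieldType) (n d : nat)
    (I : set {mpoly k[n.+1]}) : Prop :=
  GT_system d I /\ monomial_ideal I.

(* The subgroup of GL(m, k) generated by a set [S] of invertible matrices. *)
Inductive GL_generated (k : fieldType) (m : nat) (S : set 'M[k]_m) :
    'M[k]_m -> Prop :=
| GL_generated_in A : S A -> GL_generated S A
| GL_generated_one : GL_generated S 1%:M
| GL_generated_mul A B :
    GL_generated S A -> GL_generated S B -> GL_generated S (A *m B)
| GL_generated_inv A : GL_generated S A -> GL_generated S (invmx A).

Definition has_order (k : fieldType) (m : nat) (G : set 'M[k]_m) (N : nat) : Prop :=
  exists s : seq 'M[k]_m, [/\ uniq s, size s = N & forall A, G A <-> A \in s].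

(* The action x_i |-> c_i x_i of diag(c_0, ..., c_(m-1)) on polynomials. *)
Definition diag_act (k : fieldType) (m : nat) (c : 'rV[k]_m) (p : {mpoly k[m]}) :
    {mpoly k[m]} :=
  p \mPo [tuple c 0 i *: 'X_i | i < m].

(* Invariance under a group [G] all of whose elements are diagonal. *)
Definition diag_invariant (k : fieldType) (m : nat) (G : set 'M[k]_m)
    (p : {mpoly k[m]}) : Prop :=
  forall c : 'rV[k]_m, G (diag_mx c) -> diag_act c p = p.

(* Main.v *)
Require Import Defs.
From HB Require Import structures.
From mathcomp Require Import all_boot all_order all_algebra.
From mathcomp Require Import generic_quotient.
From mathcomp Require Import mpoly.
From mathcomp Require Import boolp classical_sets.

Set Implicit Arguments.
Unset Strict Implicit.
Unset Printing Implicit Defensive.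

Import GRing.Theory.

Local Open Scope classical_set_scope.
Local Open Scope ring_scope.
Local Open Scope quotient_scope.

(** The ideal is artinian because the pure powers x_j^d are invariant.

WLP fails in degree d - 1 for two reasons.  Multiplication by a linear form
L is not injective: the other factors of the norm of L under the cyclic
group multiply to a form p of degree d - 1, and L p, being an invariant form
of degree d, lies in the ideal, while p does not for degree reasons
([norm_kernel]).  It is not surjective either: by the bound on the number mu
of generators, the source of (p, c) |-> L p + sum_i c_i m_i has dimension at
most that of the space of forms of degree d, so surjectivity would force
injectivity ([fails_WLP_dim]).

The map phi given by the invariant monomials has closed image, cut out by
the binomials X^u - X^w that vanish on it ([monomial_map_closed]).  To find
a preimage of a zero y of these binomials, take d-th roots of the
coordinates of y at the pure powers; the remaining discrepancies are d-th
roots of unity, to be absorbed into a torsion point of the torus, and the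
binomial equations say exactly that this linear system over Z/dZ has no
contradictory consequence.  Such a system is solvable ([root_unity_system]),
by a character sum.

Finiteness of phi over the chart where the j-th pure power is nonzero comes
from the fact that a regular function on the chart x_j <> 0 of P^n is a
polynomial in the quotients x_i / x_j ([regular_chart]): the monomials in
these quotients with exponents less than d generate the functions upstairs
over the polynomials in the quotients of pure powers.  That fact is proved by
interpolation, without the Nullstellensatz or unique factorization.  On every
line the function is a polynomial in one variable; one relation b h = a with
b <> 0 bounds the degrees along generic lines, hence h is reproduced by
Lagrange interpolation in each coordinate separately, first generically and
then everywhere by density.

The fibre over the image of [1 : 0 : ... : 0] is a single point, so Aut(phi)
acts transitively on it.  The group Aut(phi) itself is computed over the
torus: if y and t y have the same image, normalise t_0 = 1; then t takes the
value 1 on all invariant monomials of degree d.  Among any d elements of Z/dZ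
some nonempty subfamily has sum zero, so any zero-sum sequence splits into
zero-sum sequences of length at most d, and these become monomials of degree
d after padding with x_0.  Thus t satisfies all the relations that hold on
the cyclic group, and t lies in it by [root_unity_system]
([torus_stabilizer]).  A deck transformation g therefore agrees at each torus
point with one of d diagonal maps, and with one and the same of them
everywhere because P^n is irreducible ([deck_is_diag]).  The kernel of the
action is dZ because, if a power of the generator with exponent not divisible by d
were scalar, the group generated together with the scalar matrix e would have
fewer than d^2 elements ([scalar_power_dvd]). *)

(** * Linear systems over Z/dZ, written multiplicatively *)

Lemma natr_neq0 (k : fieldType) (m : nat) :
  [pchar k] =i pred0 -> (m%:R == 0 :> k) = (m == 0)%N.
Proof. by move=> k0; exact: (pcharf0P k).1. Qed.

Lemma unity_neq0 (k : fieldType) (d : nat) (x : k) :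
  (0 < d)%N -> x ^+ d = 1 -> x != 0.
Proof.
move=> d0 xd; apply: contraTneq (oner_neq0 k) => x0.
by rewrite -xd x0 expr0n gtn_eqF //= eqxx.
Qed.

Lemma geometric_sum_root (k : fieldType) (d : nat) (b : k) :
  b ^+ d = 1 -> \sum_(u < d) b ^+ u = if b == 1 then d%:R else 0.
Proof.
move=> bd; case: eqP => [->|/eqP b1].
  by under eq_bigr do rewrite expr1n; rewrite sumr_const card_ord.
have /eqP := subrX1 b d; rewrite bd subrr eq_sym mulf_eq0 subr_eq0 (negbTE b1).
by move/eqP.
Qed.

(** The unknowns are exponents w_s modulo d, with one equation
prod_s e^(w_s A_(a,s)) = z_a for each a; the hypothesis says that every
Z-linear combination of the equations whose left side vanishes modulo d has
trivial right side.  For a given w let beta_a be the quotient of the two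
sides of equation a, a d-th root of unity.  The product over a of the sums
1 + beta_a + ... + beta_a^(d-1) is nonzero only if w is a solution.  Summing
it over all w and expanding, each term gives d^|S| if it comes from a
combination with vanishing left side, and 0 otherwise; the empty combination
contributes, so the total is nonzero in characteristic zero. *)
Lemma root_unity_system (k : fieldType) (d : nat) (e : k) (T S : finType)
    (A : T -> S -> nat) (z : T -> k) :
  [pchar k] =i pred0 -> d.-primitive_root e ->
  (forall f : T -> nat, (forall s, d %| \sum_a f a * A a s)%N ->
     \prod_a z a ^+ f a = 1) ->
  exists w : {ffun S -> 'I_d}, forall a, \prod_s e ^+ (w s * A a s) = z a.
Proof.
move=> k0 ep rel.
have d0 := prim_order_gt0 ep.
have zd a : z a ^+ d = 1.
  have := rel (fun b => if b == a then d else 0)%N.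
  rewrite (bigD1 a) //= eqxx big1 ?mulr1; last by move=> b /negbTE->.
  by apply=> s; apply: dvdn_sum => b _; case: eqP => _; rewrite ?mul0n ?dvdn_mulr.
have z0 a : z a != 0 := unity_neq0 d0 (zd a).
pose beta (w : {ffun S -> 'I_d}) a := \prod_s e ^+ (w s * A a s) / z a.
have beta_d w a : beta w a ^+ d = 1.
  rewrite expr_div_n zd divr1 -prodrXl big1 // => s _.
  by rewrite -exprM mulnC exprM (prim_expr_order ep) expr1n.
have [/existsP[w /forallP w1]|] :=
    boolP [exists w : {ffun S -> 'I_d}, [forall a, beta w a == 1]].
  exists w => a; have /eqP := w1 a.
  by rewrite /beta => /(canRL (divfK (z0 a))); rewrite mul1r.
rewrite negb_exists => /forallP now; exfalso.
have vanish : \sum_w \prod_a \sum_(u < d) beta w a ^+ u = 0.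
  rewrite big1 // => w _; have := now w; rewrite negb_forall => /existsP[a wa].
  by rewrite (bigD1 a) //= geometric_sum_root // (negbTE wa) mul0r.
(* combinations of equations with vanishing left side; distributing the
   product of sums over a gives one term for each f *)
pose good (f : {ffun T -> 'I_d}) := [forall s, d %| \sum_a f a * A a s]%N.
suff count : \sum_w \prod_a \sum_(u < d) beta w a ^+ u =
    (\sum_(f | good f) (d ^ #|S|)%N)%:R :> k.
  move/eqP: vanish; rewrite count natr_neq0 // sum_nat_const muln_eq0.
  rewrite expn_eq0 [d == 0%N]gtn_eqF //=.
  rewrite orbF => /pred0P/(_ [ffun=> Ordinal d0]) /negP; apply.
  by apply/forallP => s; apply: dvdn_sum => a _; rewrite ffunE.
under [LHS]eq_bigr => w _ do rewrite (bigA_distr_bigA (fun a (u : 'I_d) => beta w a ^+ u)).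
rewrite [LHS]exchange_big /= natr_sum (bigID good) /= [X in _ + X]big1 ?addr0.
  apply: eq_bigr => f /forallP gf.
  rewrite (eq_bigr (fun=> 1)) ?sumr_const ?card_ffun ?card_ord // => w _.
  under eq_bigr do rewrite expr_div_n.
  rewrite prodf_div rel // divr1.
  under eq_bigr do rewrite -prodrXl.
  rewrite exchange_big /= big1 // => s _.
  under eq_bigr do rewrite -exprM -mulnA.
  rewrite prodrXr -big_distrr /= exprM.
  have /dvdnP[q ->] : (d %| \sum_a A a s * f a)%N.
    by under eq_bigr do rewrite mulnC; apply: gf.
  by rewrite -exprM mulnA mulnC exprM (prim_expr_order ep) ?expr1n.
move=> f; rewrite negb_forall => /existsP[s fs].
under eq_bigr => w _.
  under eq_bigr do rewrite expr_div_n.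
  rewrite prodf_div.
  under eq_bigr do rewrite -prodrXl.
  rewrite exchange_big /=.
  under eq_bigr => t _.
    under eq_bigr do rewrite -exprM -mulnA.
    rewrite prodrXr -big_distrr /= mulnC exprM.
    over.
  over.
rewrite -big_distrl /= -(bigA_distr_bigA (fun t (u : 'I_d) =>
  (e ^+ (\sum_a A a t * f a)) ^+ u)) (bigD1 s) //= geometric_sum_root.
  by rewrite -(prim_order_dvd ep); under eq_bigr do rewrite mulnC;
     rewrite (negbTE fs) !mul0r.
by rewrite -exprM mulnC exprM (prim_expr_order ep) ?expr1n.
Qed.

(** * Values and homogeneity of multivariate polynomials *)

Lemma meval_homog_scale (k : fieldType) (m e : nat) (p : {mpoly k[m]}) (c : k)
    (v : 'I_m -> k) :
  p \is e.-homog -> p.@[fun i => c * v i] = c ^+ e * p.@[v].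
Proof.
move=> /dhomogP ph; rewrite !mevalE mulr_sumr [LHS]big_seq [RHS]big_seq.
apply: eq_bigr => a /ph /= <-; under eq_bigr do rewrite exprMn.
by rewrite big_split /= prodrXr mdegE mulrCA.
Qed.

Lemma dhomog_prodf (k : fieldType) (m : nat) (I : Type) (r : seq I)
    (F : I -> {mpoly k[m]}) (E : I -> nat) :
  (forall i, F i \is (E i).-homog) ->
  \prod_(i <- r) F i \is (\sum_(i <- r) E i).-homog.
Proof.
move=> h; elim/big_rec2: _ => [|i n p _ hp]; first exact: dhomog1.
exact: dhomogM.
Qed.

Lemma dhomog_comp (k : fieldType) (m r d e : nat) (p : {mpoly k[r]})
    (G : 'I_r -> {mpoly k[m]}) :
  p \is e.-homog -> (forall j, G j \is d.-homog) ->
  p \mPo [tuple G j | j < r] \is (d * e).-homog.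
Proof.
move=> /dhomogP ph Gh; rewrite comp_mpolyEX big_seq.
apply: rpred_sum => a /ph /= <-; apply: dhomogZ; rewrite comp_mpolyX mdegE big_distrr /=.
by apply: dhomog_prodf => j; rewrite tnth_mktuple; apply: dhomogMn.
Qed.

Lemma meval_comp (k : fieldType) (m r : nat) (p : {mpoly k[r]})
    (G : 'I_r -> {mpoly k[m]}) (v : 'I_m -> k) :
  (p \mPo [tuple G j | j < r]).@[v] = p.@[fun j => (G j).@[v]].
Proof. by rewrite comp_mpoly_meval; apply: meval_eq => j; rewrite tnth_mktuple. Qed.

Lemma horner_mmap (k : fieldType) (m : nat) (l : 'I_m -> {poly k})
    (p : {mpoly k[m]}) (t : k) :
  (mmap polyC l p).[t] = p.@[fun i => (l i).[t]].
Proof.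
rewrite mevalE /mmap horner_sum; apply: eq_bigr => a _.
by rewrite hornerM hornerC /mmap1 horner_prod; under eq_bigr do rewrite horner_exp.
Qed.

Lemma size_mmap_line (k : fieldType) (m : nat) (l : 'I_m -> {poly k})
    (p : {mpoly k[m]}) :
  (forall i, (size (l i) <= 2)%N) -> (size (mmap polyC l p) <= msize p)%N.
Proof.
move=> sl; rewrite /mmap; apply: (leq_trans (size_sum _ _ _)).
apply/bigmax_leqP_seq => a ap _; rewrite mul_polyC.
apply: (leq_trans (size_scale_leq _ _)).
apply: leq_trans (msize_mdeg_lt ap); rewrite mdegE /mmap1.
elim/big_rec2: _ => [|i q n _ IH]; first by rewrite size_poly1.
apply: (leq_trans (size_polyMleq _ _)).
have sx : (size (l i ^+ a i) <= (a i).+1)%N.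
  apply: (leq_trans (size_poly_exp_leq _ _)); rewrite ltnS.
  by have := sl i; case: (size (l i)) => [|[|[|]]] //= _; rewrite ?mul0n ?mul1n.
have := leq_add sx IH; rewrite addSn addnS -!subn1 => h.
by apply: (leq_trans (leq_sub2r 1 h)); rewrite subn1.
Qed.

(** Uniqueness of base-B digits; this keeps monomials apart under the substitution
X_i := T^(B^i). *)
Lemma digits_inj (m B : nat) (a b : 'I_m -> nat) :
  (forall i, a i < B)%N -> (forall i, b i < B)%N ->
  (\sum_i a i * B ^ i = \sum_i b i * B ^ i)%N -> a =1 b.
Proof.
elim: m a b => [|m IH] a b aB bB; first by move=> _ [].
have split (c : 'I_m.+1 -> nat) :
    (\sum_i c i * B ^ i = c ord0 + B * \sum_i c (lift ord0 i) * B ^ i)%N.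
  rewrite big_ord_recl muln1 big_distrr /=; congr (_ + _)%N.
  by apply: eq_bigr => i _; rewrite /bump add1n expnS mulnCA.
have B0 : (0 < B)%N := leq_ltn_trans (leq0n _) (aB ord0).
rewrite !split => eqab.
have e0 : a ord0 = b ord0.
  have := congr1 (modn^~ B) eqab.
  by rewrite /= ![(B * _)%N]mulnC ![(_ + _ * B)%N]addnC !modnMDl !modn_small.
move: eqab; rewrite e0 => /addnI /eqP; rewrite eqn_pmul2l // => /eqP eqab i.
have [j ->|->//] := unliftP ord0 i.
exact: (IH (fun j => a (lift ord0 j)) (fun j => b (lift ord0 j))).
Qed.

Lemma natr_inj (k : fieldType) :
  [pchar k] =i pred0 -> injective (fun i => i%:R : k).
Proof.
move=> k0 i j /eqP; wlog le_ij : i j / (i <= j)%N.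
  by case/orP: (leq_total i j) => ? h; [|rewrite eq_sym => ?; apply/esym]; apply: h.
rewrite eq_sym -subr_eq0 -natrB // natr_neq0 // subn_eq0 => ji.
by apply/eqP; rewrite eqn_leq le_ij.
Qed.

Lemma poly_nonroot (k : fieldType) (q : {poly k}) :
  [pchar k] =i pred0 -> q != 0 -> exists t, q.[t] != 0.
Proof.
move=> k0 q0; pose s : seq k := [seq i%:R | i <- iota 0 (size q)].
have us : uniq s by rewrite (map_inj_uniq (natr_inj k0)) iota_uniq.
have : ~~ all (root q) s.
  apply: contra q0 => rs; apply/eqP/(roots_geq_poly_eq0 rs us).
  by rewrite size_map size_iota.
by case/allPn => t _ qt; exists t.
Qed.

(** Kronecker substitution X_i := T^(B^i) with B larger than all exponents sends
distinct monomials to distinct powers of T, so that p becomes a nonzero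
polynomial in one variable, and that has a non-root. *)
Lemma mpoly_nonvanishing (k : fieldType) (m : nat) (p : {mpoly k[m]}) :
  [pchar k] =i pred0 -> p != 0 -> exists v, p.@[v] != 0.
Proof.
move=> k0 p0; pose B := msize p.
pose l (i : 'I_m) : {poly k} := 'X^(B ^ i).
pose q := mmap polyC l p.
have qE : q = \sum_(a <- msupp p) p@_a *: 'X^(\sum_i a i * B ^ i).
  rewrite /q /mmap; apply: eq_bigr => a _; rewrite mul_polyC; congr (_ *: _).
  by rewrite /mmap1 -prodrXr; apply: eq_bigr => i _; rewrite -exprM mulnC.
have small (a : 'X_{1..m}) i : a \in msupp p -> (a i < B)%N.
  move=> ap; apply: leq_ltn_trans (msize_mdeg_lt ap).
  by rewrite mdegE (bigD1 i) //= leq_addr.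
have q0 : q != 0.
  have mp := mlead_supp p0.
  suff : q`_(\sum_i mlead p i * B ^ i) != 0.
    by apply: contraNneq => ->; rewrite coef0.
  rewrite qE coef_sum (bigD1_seq _ mp (msupp_uniq _)) /= coefZ coefXn eqxx mulr1.
  rewrite big_seq_cond big1 ?addr0 -?mcoeff_msupp // => a /andP[ap ne].
  rewrite coefZ coefXn; case: eqP => [eqs|]; last by rewrite mulr0.
  case/eqP: ne; apply/mnmP; apply/(@digits_inj _ B); last exact/esym.
    by move=> i; apply: small.
  by move=> i; apply: small.
have [t] := poly_nonroot k0 q0.
by rewrite horner_mmap => ?; exists (fun i => (l i).[t]).
Qed.

Lemma meval_prod (k : fieldType) (m : nat) (I : Type) (r : seq I)
    (F : I -> {mpoly k[m]}) v :
  (\prod_(i <- r) F i).@[v] = \prod_(i <- r) (F i).@[v].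
Proof. exact: (big_morph _ (mevalM v) (meval1 v)). Qed.

(** * Projective space and maps given by forms *)

Lemma coords_neq0 (k : fieldType) (m : nat) (x : proj k m) : coords x != 0.
Proof. exact: valP (repr x). Qed.

Lemma rV_neq0_ex (k : fieldType) (m : nat) (v : 'rV[k]_m) :
  v != 0 -> exists j, v 0 j != 0.
Proof.
move=> /negP v0; apply: contrapT => /forallNP h; apply: v0.
by apply/eqP/rowP => i; rewrite mxE; have /negP := h i; rewrite negbK => /eqP.
Qed.

Lemma coords_neq0_ex (k : fieldType) (m : nat) (x : proj k m) :
  exists j, coords x 0 j != 0.
Proof. exact: rV_neq0_ex (coords_neq0 x). Qed.

Lemma is_pointP (k : fieldType) (m : nat) (v : 'rV[k]_m) (x : proj k m) :
  is_point v x <-> exists2 c, c != 0 & v = c *: coords x.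
Proof.
split=> [[v0 xE]|[c c0 vE]].
  have : proportional (exist _ v v0) (repr x).
    by apply/eqmodP; rewrite -xE reprK.
  case/andP => /sub_rVP[c /= vE] _; exists c => //.
  by apply: contraNneq (v0) => c0; rewrite vE c0 scale0r.
have v0 : v != 0 by rewrite vE scaler_eq0 negb_or c0 coords_neq0.
exists v0; rewrite -[x]reprK; apply/eqmodP => /=.
rewrite /proportional /= vE; apply/andP; split.
  by apply/sub_rVP; exists c^-1; rewrite scalerA mulVf ?scale1r.
by apply/sub_rVP; exists c.
Qed.

Lemma is_point_coords (k : fieldType) (m : nat) (x : proj k m) :
  is_point (coords x) x.
Proof. by apply/is_pointP; exists 1; rewrite ?oner_neq0 ?scale1r. Qed.

Lemma is_point_scale (k : fieldType) (m : nat) (v : 'rV[k]_m) (c : k)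
    (x : proj k m) :
  c != 0 -> is_point v x -> is_point (c *: v) x.
Proof.
move=> c0 /is_pointP[b b0 ->]; apply/is_pointP; exists (c * b).
  by rewrite mulf_neq0.
by rewrite scalerA.
Qed.

Lemma is_point_inj (k : fieldType) (m : nat) (v : 'rV[k]_m) (x y : proj k m) :
  is_point v x -> is_point v y -> x = y.
Proof.
by move=> [v0 ->] [v0' ->]; congr (\pi_(proj k m) (exist _ v _));
   apply: bool_irrelevance.
Qed.

Lemma is_point_exists (k : fieldType) (m : nat) (v : 'rV[k]_m) :
  v != 0 -> exists x, is_point v x.
Proof. by move=> v0; exists (\pi_(proj k m) (exist _ v v0)), v0. Qed.

Lemma pval_is_point (k : fieldType) (m : nat) (v : 'rV[k]_m) (x : proj k m) :
  is_point v x -> exists2 c, c != 0 & forall (e : nat) (p : {mpoly k[m]}),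
    p \is e.-homog -> p.@[fun i => v 0 i] = c ^+ e * pval p x.
Proof.
move=> /is_pointP[c c0 ->]; exists c => // e p ph.
rewrite -(meval_homog_scale c _ ph); apply: meval_eq => i.
by rewrite mxE.
Qed.

Lemma pvalX (k : fieldType) (m : nat) (j : 'I_m) (x : proj k m) :
  pval 'X_j x = coords x 0 j.
Proof. exact: mevalXU. Qed.

Lemma zariski_closed0 (k : fieldType) (m : nat) : zariski_closed (@set0 (proj k m)).
Proof.
exists [set 1]; split=> [p ->|]; first by exists 0%N; apply: dhomog1.
rewrite predeqE => x; split=> // /(_ 1 erefl).
by rewrite /pval meval1 => /eqP; rewrite oner_eq0.
Qed.

Lemma zariski_closedT (k : fieldType) (m : nat) : zariski_closed (@setT (proj k m)).
Proof. by exists set0; split=> [p []|]; rewrite predeqE => x; split=> // _ p []. Qed.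

Lemma zariski_openT (k : fieldType) (m : nat) : zariski_open (@setT (proj k m)).
Proof. by rewrite /zariski_open setCT; apply: zariski_closed0. Qed.

Lemma zariski_open_nonvanishing (k : fieldType) (m e : nat) (p : {mpoly k[m]}) :
  p \is e.-homog -> zariski_open [set x | pval p x != 0].
Proof.
move=> ph; exists [set p]; split=> [q ->|]; first by exists e.
rewrite predeqE => x; split=> [/negP|/(_ p erefl) px].
  by rewrite negbK => /eqP px q ->.
by apply/negP; rewrite negbK px.
Qed.

Lemma zariski_open_coord (k : fieldType) (m : nat) (j : 'I_m) :
  zariski_open [set x : proj k m | coords x 0 j != 0].
Proof.
have := @zariski_open_nonvanishing k m 1%N 'X_j; rewrite dhomogX /= mdeg1 eqxx.
by move=> /(_ isT); congr zariski_open; rewrite predeqE => x /=; rewrite pvalX.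
Qed.

Lemma zariski_open_basic (k : fieldType) (m : nat) (U : set (proj k m)) x :
  zariski_open U -> U x -> exists (e : nat) (s : {mpoly k[m]}),
    [/\ s \is e.-homog, pval s x != 0 & forall y, pval s y != 0 -> U y].
Proof.
move=> [S [Sh UE]] Ux.
have : ~ (~` U) x by apply.
rewrite UE => /existsNP[s /not_implyP[Ss /eqP sx]].
have [e sh] := Sh _ Ss; exists e, s; split=> // y sy.
apply: contrapT => nUy; have : (~` U) y by [].
by rewrite UE => /(_ s Ss) /eqP; rewrite (negbTE sy).
Qed.

(** Morphisms of projective spaces given globally by one family of forms of the
same degree; all the explicit maps below are of this kind. *)
Definition form_map (k : fieldType) (m r d : nat) (G : 'I_r -> {mpoly k[m]})
    (f : proj k m -> proj k r) : Prop :=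
  (forall j, G j \is d.-homog) /\
  forall x, is_point (\row_j pval (G j) x) (f x).

Lemma form_map_exists (k : fieldType) (m r d : nat) (G : 'I_r -> {mpoly k[m]}) :
  (forall j, G j \is d.-homog) -> (forall x, exists j, pval (G j) x != 0) ->
  exists f, form_map d G f.
Proof.
move=> Gh G0.
have /boolp.choice[f fP] : forall x, exists y, is_point (\row_j pval (G j) x) y.
  move=> x; apply: is_point_exists; have [j] := G0 x.
  by apply: contraNneq => /rowP/(_ j); rewrite !mxE => ->.
by exists f.
Qed.

(** Values of p at the image are values of the pulled back form, up to a factor
that depends on the chosen representatives and on the degree of p only. *)
Lemma form_map_pval (k : fieldType) (m r d : nat) (G : 'I_r -> {mpoly k[m]}) f :
  form_map d G f -> forall x, exists2 c, c != 0 &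
    forall (e : nat) (p : {mpoly k[r]}), p \is e.-homog ->
      pval (p \mPo [tuple G j | j < r]) x = c ^+ e * pval p (f x).
Proof.
move=> [Gh fP] x; have [c c0 h] := pval_is_point (fP x); exists c => // e p ph.
rewrite -(h _ _ ph) /pval meval_comp; apply: meval_eq => j.
by rewrite mxE.
Qed.

Lemma preimage_closed (k : fieldType) (m r d : nat) (G : 'I_r -> {mpoly k[m]}) f
    (Z : set (proj k r)) :
  form_map d G f -> zariski_closed Z -> zariski_closed (f @^-1` Z).
Proof.
move=> fG [S [Sh ->]].
exists [set p \mPo [tuple G j | j < r] | p in S]; split.
  move=> _ [p /Sh[e pe] <-]; exists (d * e)%N.
  by apply: dhomog_comp => //; case: fG.
rewrite predeqE => x; have [c c0 h] := form_map_pval fG x; split=> /= H.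
  by move=> _ [p Sp <-]; have [e pe] := Sh _ Sp; rewrite (h _ _ pe) H ?mulr0.
move=> p Sp; have [e pe] := Sh _ Sp.
have /eqP := H _ (ex_intro2 _ _ p Sp erefl).
by rewrite (h _ _ pe) mulf_eq0 expf_eq0 (negbTE c0) andbF => /eqP.
Qed.

Lemma form_map_morphism (k : fieldType) (m r d : nat) (G : 'I_r -> {mpoly k[m]}) f
    (V : set (proj k m)) (W : set (proj k r)) :
  form_map d G f -> (forall x, V x -> W (f x)) -> morphism V W f.
Proof.
move=> [Gh fP] VW; split=> // x Vx; exists d, G, setT; split=> //.
exact: zariski_openT.
Qed.

(** The product of p and all the coordinates is again nonzero, and a point where it
does not vanish lies in the torus. *)
Lemma torus_nonvanishing (k : fieldType) (m e : nat) (p : {mpoly k[m.+1]}) :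
  [pchar k] =i pred0 -> p \is e.-homog -> p != 0 ->
  exists x, pval p x != 0 /\ forall j, coords x 0 j != 0.
Proof.
move=> k0 ph p0; pose q := p * \prod_j 'X_j.
have q0 : q != 0.
  rewrite mulf_neq0 //; apply/prodf_neq0 => j _.
  by rewrite -msize_poly_eq0 msizeX.
have [v] := mpoly_nonvanishing k0 q0.
rewrite mevalM meval_prod mulf_eq0 negb_or => /andP[pv /prodf_neq0 vX].
have v0 : (\row_i v i) != 0.
  have := vX ord0 isT; rewrite mevalXU; apply: contraNneq => /rowP/(_ ord0).
  by rewrite !mxE => ->.
have [x xP] := is_point_exists v0; exists x.
have [c c0 h] := pval_is_point xP.
have pE : p.@[fun i => (\row_i v i) 0 i] = p.@[v].
  by apply: meval_eq => i; rewrite mxE.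
split=> [|j].
  by move: pv; rewrite -pE (h _ _ ph); apply: contraNneq => ->; rewrite mulr0.
have := vX j isT; have := h 1%N 'X_j; rewrite dhomogX /= mdeg1 => /(_ isT).
by rewrite !mevalXU mxE => ->; rewrite mulf_eq0 negb_or pvalX => /andP[].
Qed.

Lemma irreducible_proj (k : fieldType) (m : nat) :
  [pchar k] =i pred0 -> irreducible (@setT (proj k m.+1)).
Proof.
move=> k0; split.
  have [x _] := torus_nonvanishing k0 (dhomog1 k mdeg) (oner_neq0 {mpoly k[m.+1]}).
  by exists x.
move=> A B [SA [SAh ->]] [SB [SBh ->]] AB.
apply: contrapT => /not_orP[]; rewrite /subset.
move=> /existsNP[x /not_implyP[_ /existsNP[p /not_implyP[Sp /eqP px]]]].
move=> /existsNP[y /not_implyP[_ /existsNP[q /not_implyP[Sq /eqP qy]]]].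
have nz (r : {mpoly k[m.+1]}) z : pval r z != 0 -> r != 0.
  by apply: contraNneq => ->; rewrite /pval meval0.
have [e pe] := SAh _ Sp; have [e' qe] := SBh _ Sq.
have [z [pqz _]] := torus_nonvanishing k0 (dhomogM pe qe)
  (mulf_neq0 (nz _ _ px) (nz _ _ qy)).
move: pqz; rewrite /pval mevalM mulf_eq0 negb_or => /andP[pz qz].
case: (AB z) => // [/(_ p Sp)|/(_ q Sq)] /eqP; first by rewrite (negbTE pz).
by rewrite (negbTE qz).
Qed.

Lemma irreducible_range (k : fieldType) (m r d : nat) (G : 'I_r -> {mpoly k[m]}) f :
  form_map d G f -> irreducible (@setT (proj k m)) -> irreducible (range f).
Proof.
move=> fG [[x _] irr]; split; first by exists (f x), x.
move=> A B Ac Bc AB.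
have [|h|h] := irr _ _ (preimage_closed fG Ac) (preimage_closed fG Bc).
- by move=> y _; apply: AB; exists y.
- by left=> _ [y _ <-]; apply: h.
- by right=> _ [y _ <-]; apply: h.
Qed.

(** Exchanging the coordinates 0 and j is an involution of projective space that
moves the chart x_j <> 0 to the standard one. *)
Lemma affine_closed_chart (k : fieldType) (m : nat) (X : set (proj k m.+1))
    (j : 'I_m.+1) :
  zariski_closed X -> affine (X `&` [set x | coords x 0 j != 0]).
Proof.
move=> Xc; pose s i := if i == j then ord0 else if i == ord0 then j else i.
have sK : involutive s.
  move=> i; rewrite /s; have [->|ij] := eqVneq i j.
    by have [->|] := eqVneq; rewrite ?eqxx.
  by have [->|i0] := eqVneq i ord0; rewrite ?eqxx // (negbTE ij) (negbTE i0).
have sj : s j = ord0 by rewrite /s eqxx.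
have s0 : s ord0 = j by rewrite -sj sK.
pose G i : {mpoly k[m.+1]} := 'X_(s i).
have [||f fG] := @form_map_exists k m.+1 m.+1 1%N G.
- by move=> i; rewrite dhomogX /= mdeg1.
- move=> x; have [i xi] := coords_neq0_ex x.
  by exists (s i); rewrite pvalX sK.
have fc x : exists2 c, c != 0 & forall i, coords x 0 (s i) = c * coords (f x) 0 i.
  have /is_pointP[c c0 /rowP h] := fG.2 x; exists c => // i.
  by have := h i; rewrite !mxE pvalX.
have ffK x : f (f x) = x.
  have [c c0 hc] := fc x; apply: (is_point_inj (fG.2 (f x))).
  have -> : \row_i pval (G i) (f x) = c^-1 *: coords x.
    apply/rowP => i; rewrite !mxE pvalX -[i in RHS]sK hc mulKf //.
  by apply: is_point_scale (is_point_coords x); rewrite invr_eq0.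
exists m, (f @^-1` X); split; first exact: preimage_closed fG Xc.
exists f, f; split=> //.
- apply: (form_map_morphism fG) => x [Xx xj]; split=> /=; first by rewrite ffK.
  have [c c0 hc] := fc x; move: xj => /=.
  by rewrite -s0 hc mulf_eq0 negb_or => /andP[].
- apply: (form_map_morphism fG) => x [Xx xj]; split=> //=.
  have [c c0 hc] := fc x; move: xj => /=.
  rewrite /affine_chart /=.
  by rewrite -sj hc mulf_eq0 negb_or => /andP[].
Qed.

(** * Locally rational functions on affine space are polynomials *)

(** A nonempty Zariski open subset of the line is dense. *)
Lemma poly_eq0_off_roots (k : fieldType) (p q : {poly k}) :
  [pchar k] =i pred0 -> q != 0 -> (forall t, q.[t] != 0 -> p.[t] = 0) -> p = 0.
Proof.
move=> k0 q0 pq; apply/eqP; apply: contraT => p0.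
have [t] := poly_nonroot k0 (mulf_neq0 p0 q0).
by rewrite hornerM mulf_eq0 negb_or => /andP[pt /pq]; move/eqP: pt.
Qed.

(** Take a relation b h = a with b of least degree.  If b had a root t0, then a
would vanish there too; a relation with denominator nonzero at t0 shows that
the common factor X - t0 may be cancelled. *)
Lemma locally_rational_poly (k : closedFieldType) (h : k -> k) :
  [pchar k] =i pred0 ->
  (forall t0, exists a b : {poly k},
     b.[t0] != 0 /\ forall t, b.[t] * h t = a.[t]) ->
  exists f : {poly k}, forall t, h t = f.[t].
Proof.
move=> k0 loc.
suff red N : forall a b : {poly k}, (size b <= N)%N -> b != 0 ->
    (forall t, b.[t] * h t = a.[t]) -> exists f : {poly k}, forall t, h t = f.[t].
  have [a [b [b0 h0]]] := loc 0; apply: (red (size b) a b) => //.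
  by apply: contraNneq b0 => ->; rewrite horner0.
elim: N => [|N IH] a b sb b0 ab.
  by move: sb; rewrite leqn0 size_poly_eq0 (negbTE b0).
have [/eqP/size_poly1P[c c0 bE]|sb1] := eqVneq (size b) 1%N.
  exists (c^-1 *: a) => t; rewrite hornerZ -ab bE hornerC mulKf //.
have [t0 bt0] := closed_rootP b sb1.
have [a1 [b1 [b10 ab1]]] := loc t0.
have [b' bE] := factor_theorem _ _ bt0.
(* b vanishes at t0, hence so does a = b h *)
have at0 : root a t0 by rewrite /root -ab (eqP bt0) mul0r.
have [a' aE] := factor_theorem _ _ at0.
have b'0 : b' != 0 by apply: contraNneq b0 => b'0; rewrite bE b'0 mul0r.
have off t : t != t0 -> b'.[t] * h t = a'.[t].
  move=> tt0; have := ab t; rewrite bE aE !hornerM hornerXsubC mulrAC.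
  by apply: mulIf; rewrite subr_eq0.
apply: (IH a' b') => //.
  by move: sb; rewrite bE size_Mmonic ?monicXsubC // size_XsubC addn2.
move=> t; have [->|/off//] := eqVneq t t0.
have e : b' * a1 - b1 * a' = 0.
  apply: (@poly_eq0_off_roots _ _ ('X - t0%:P) k0); rewrite ?polyXsubC_eq0 // => s.
  rewrite hornerXsubC subr_eq0 hornerD hornerN !hornerM => /off <-.
  by rewrite -ab1 mulrCA subrr.
apply: (mulfI b10); rewrite mulrCA ab1; apply/eqP.
by rewrite -subr_eq0 -!hornerM -hornerN -hornerD e horner0.
Qed.

(** Being locally a quotient a / b is expressed by relations b h = a on the whole
space, with b nonzero at the given point: a relation on a basic open set
s <> 0 becomes global after multiplication by s. *)
Definition locally_rational (k : fieldType) (N : nat) (h : ('I_N -> k) -> k) :=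
  forall u, exists a b : {mpoly k[N]},
    b.@[u] != 0 /\ forall v, b.@[v] * h v = a.@[v].

Definition line (k : fieldType) (N : nat) (u v : 'I_N -> k) (t : k) : 'I_N -> k :=
  fun i => u i + v i * t.

Definition line_poly (k : fieldType) (N : nat) (u v : 'I_N -> k) i : {poly k} :=
  (u i)%:P + v i *: 'X.

Lemma meval_line (k : fieldType) (N : nat) (p : {mpoly k[N]}) u v t :
  (mmap polyC (line_poly u v) p).[t] = p.@[line u v t].
Proof.
rewrite horner_mmap; apply: meval_eq => i.
by rewrite /line_poly hornerD hornerC hornerZ hornerX.
Qed.

Lemma size_meval_line (k : fieldType) (N : nat) (p : {mpoly k[N]}) u v :
  (size (mmap polyC (line_poly u v) p) <= msize p)%N.
Proof.
apply: size_mmap_line => i; apply: (leq_trans (size_polyD _ _)).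
rewrite geq_max (leq_trans (size_polyC_leq1 _)) //.
by rewrite (leq_trans (size_scale_leq _ _)) ?size_polyX.
Qed.

Lemma locally_rational_line (k : closedFieldType) (N : nat)
    (h : ('I_N -> k) -> k) (u v : 'I_N -> k) :
  [pchar k] =i pred0 -> locally_rational h ->
  exists f : {poly k}, forall t, h (line u v t) = f.[t].
Proof.
move=> k0 loc; apply: locally_rational_poly => // t0.
have [a [b [b0 ab]]] := loc (line u v t0).
exists (mmap polyC (line_poly u v) a), (mmap polyC (line_poly u v) b).
by split=> [|t]; rewrite !meval_line.
Qed.

Definition upd (k : fieldType) (N : nat) (x : 'I_N -> k) (i : 'I_N) (t : k) :
  'I_N -> k := fun j => if j == i then t else x j.

(** The nodes are the images of natural numbers, distinct in characteristic zero. *)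
Lemma lagrange_basis (k : fieldType) (D : nat) :
  [pchar k] =i pred0 -> exists lag : 'I_D -> {poly k},
    forall f : {poly k}, (size f <= D)%N ->
    forall t, f.[t] = \sum_(c < D) f.[c%:R] * (lag c).[t].
Proof.
move=> k0; case: D => [|D].
  exists (fun=> 0) => f; rewrite leqn0 size_poly_eq0 => /eqP-> t.
  by rewrite horner0 big_ord0.
exists (fun c : 'I_D.+1 => tnth (lagrange D.+1 (fun i => i%:R : k)) c : {poly k}) => f sf t.
rewrite {1}(lagrange_gen (ltn0Sn D) (natr_inj k0) sf).
by rewrite horner_sum; apply: eq_bigr => c _; rewrite hornerM hornerC.
Qed.

(** One relation b h = a bounds the degree of h by that of a along every coordinate
line through a point with b <> 0, so that interpolation in the coordinate x_i
reproduces h there.  Both sides of the formula are polynomial along any line,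
and any point can be joined by a line to one where b <> 0. *)
Lemma locally_rational_interpolation (k : closedFieldType) (N : nat)
    (h : ('I_N -> k) -> k) :
  [pchar k] =i pred0 -> locally_rational h ->
  exists (D : nat) (lag : 'I_D -> {poly k}), forall x i,
    h x = \sum_(c < D) h (upd x i c%:R) * (lag c).[x i].
Proof.
move=> k0 loc; have [a [b [b0 ab]]] := loc (fun=> 0).
pose y : 'I_N -> k := fun=> 0.
have [lag lagP] := lagrange_basis (msize a) k0.
exists (msize a), lag => x i.
have generic z : b.@[z] != 0 ->
    h z = \sum_(c < msize a) h (upd z i c%:R) * (lag c).[z i].
  move=> bz; pose v : 'I_N -> k := fun j => (j == i)%:R.
  have lineE t : line (upd z i 0) v t = upd z i t.
    apply: funext => j; rewrite /line /upd /v; case: eqP => _.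
      by rewrite add0r mul1r.
    by rewrite mul0r addr0.
  have [f fP] := locally_rational_line (upd z i 0) v k0 loc.
  pose A := mmap polyC (line_poly (upd z i 0) v) a.
  pose B := mmap polyC (line_poly (upd z i 0) v) b.
  have updz : upd z i (z i) = z.
    by apply: funext => j; rewrite /upd; case: eqP => [->|].
  have B0 : B != 0.
    apply: contraNneq bz => B0; rewrite -updz -lineE -meval_line.
    by rewrite -/B B0 horner0.
  have fAB : B * f = A.
    apply/eqP; rewrite -subr_eq0; apply/eqP.
    apply: (poly_eq0_off_roots k0 (oner_neq0 _)) => t _.
    by rewrite hornerD hornerN hornerM !meval_line -fP ab subrr.
  have sf : (size f <= msize a)%N.
    have [->|f0] := eqVneq f 0; first by rewrite size_poly0.
    apply: leq_trans (size_meval_line a (upd z i 0) v); rewrite -/A -fAB.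
    rewrite size_mul //; have := B0; rewrite -size_poly_gt0.
    by case: (size B) => // s _; rewrite addSn leq_addl.
  rewrite -[in LHS]updz -lineE fP (lagP _ sf); apply: eq_bigr => c _.
  by rewrite -fP lineE.
pose v := fun j => y j - x j.
have [f fP] := locally_rational_line x v k0 loc.
have /boolp.choice[g gP] : forall c : 'I_(msize a), exists g : {poly k},
    forall t, h (line (upd x i c%:R) (upd v i 0) t) = g.[t].
  by move=> c; apply: locally_rational_line.
have lineE t c : line (upd x i c) (upd v i 0) t = upd (line x v t) i c.
  by apply: funext => j; rewrite /line /upd; case: eqP; rewrite ?mul0r ?addr0.
pose B := mmap polyC (line_poly x v) b.
have B0 : B != 0.
  apply: contraNneq b0 => B0; rewrite -[X in b.@[X]](_ : line x v 1 = _).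
    by rewrite -meval_line -/B B0 horner0.
  by apply: funext => j; rewrite /line /v mulr1 addrC subrK.
(* the difference of both sides along the line from x to y *)
pose r := f - \sum_(c < msize a) g c * (lag c \Po line_poly x v i).
have rE t : r.[t] = h (line x v t) -
    \sum_(c < msize a) h (upd (line x v t) i c%:R) * (lag c).[line x v t i].
  rewrite /r hornerD hornerN horner_sum fP; congr (_ - _); apply: eq_bigr => c _.
  rewrite hornerM horner_comp -gP lineE; congr (_ * (lag c).[_]).
  by rewrite /line_poly hornerD hornerC hornerZ hornerX.
have r0 : r = 0.
  apply: (poly_eq0_off_roots k0 B0) => t; rewrite meval_line => Bt.
  by rewrite rE generic ?subrr.
have x0 : line x v 0 = x by apply: funext => j; rewrite /line mulr0 addr0.
by apply/eqP; rewrite -subr_eq0 -x0 -rE r0 horner0.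
Qed.

Lemma mpoly_of_poly (k : fieldType) (N : nat) (q : {poly k}) (i : 'I_N) :
  exists Q : {mpoly k[N]}, forall x, Q.@[x] = q.[x i].
Proof.
exists (\sum_(j < size q) q`_j *: 'X_i ^+ j) => x.
rewrite raddf_sum horner_coef; apply: eq_bigr => j _ /=.
by rewrite mevalZ rmorphXn /= mevalXU.
Qed.

(** Interpolate the coordinates one after the other. *)
Lemma locally_rational_mpoly (k : closedFieldType) (N : nat)
    (h : ('I_N -> k) -> k) :
  [pchar k] =i pred0 -> locally_rational h ->
  exists P : {mpoly k[N]}, forall x, h x = P.@[x].
Proof.
move=> k0 loc; have [D [lag lagP]] := locally_rational_interpolation k0 loc.
pose mix m (x y : 'I_N -> k) : 'I_N -> k := fun i => if (i < m)%N then x i else y i.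
suff mixP m : (m <= N)%N -> forall y,
    exists P : {mpoly k[N]}, forall x, h (mix m x y) = P.@[x].
  have [P hP] := mixP N (leqnn N) (fun=> 0); exists P => x; rewrite -hP.
  by congr h; apply: funext => i; rewrite /mix ltn_ord.
elim: m => [|m IH] mN y.
  by exists (h y)%:MP => x; rewrite mevalC; congr h; apply: funext.
pose i := Ordinal mN.
have /boolp.choice[P PP] : forall c : 'I_D, exists P : {mpoly k[N]},
    forall x, h (mix m x (upd y i c%:R)) = P.@[x].
  by move=> c; apply: IH; apply: ltnW.
have /boolp.choice[Q QP] : forall c : 'I_D, exists Q : {mpoly k[N]},
    forall x, Q.@[x] = (lag c).[x i].
  by move=> c; apply: mpoly_of_poly.
exists (\sum_(c < D) P c * Q c) => x.
rewrite (lagP _ i) raddf_sum; apply: eq_bigr => c _ /=.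
rewrite mevalM QP -PP /mix ltnSn; congr (h _ * _); apply: funext => j.
rewrite /upd ltnS leq_eqVlt; have [->|ji] := eqVneq j i; first by rewrite ltnn.
by rewrite -[(j == m :> nat)]/(j == i) (negbTE ji).
Qed.

(** * Regular functions on a coordinate chart *)

(** Setting u_j = 1 identifies the chart with an affine space; the composite of h
with this parametrization is locally rational. *)
Lemma regular_chart (k : closedFieldType) (n : nat) (j : 'I_n.+1)
    (W : set (proj k n.+1)) (h : proj k n.+1 -> k) :
  [pchar k] =i pred0 -> (forall x, W x <-> coords x 0 j != 0) ->
  regular_on W h ->
  exists P : {mpoly k[n.+1]},
    forall x, W x -> h x = P.@[fun i => coords x 0 i / coords x 0 j].
Proof.
move=> k0 WE hreg.
have /boolp.choice[pt ptP] : forall u : 'I_n.+1 -> k, exists x,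
    is_point (\row_i upd u j 1 i) x.
  move=> u; apply: is_point_exists; apply/negP => /eqP/rowP/(_ j).
  by rewrite !mxE /upd eqxx => /eqP; rewrite oner_eq0.
have ptW u : W (pt u).
  apply/WE; have /is_pointP[c _ /rowP/(_ j)] := ptP u.
  rewrite !mxE /upd eqxx => h1; apply/eqP => xj.
  by move/eqP: h1; rewrite xj mulr0 oner_eq0.
have [|P PP] := @locally_rational_mpoly k n.+1 (h \o pt) k0.
  move=> u; have [e [p [q [U [pe qe Uo Uu hU]]]]] := hreg _ (ptW u).
  have [e' [s [se su sU]]] := zariski_open_basic Uo Uu.
  (* setting x_j := 1; multiplying p / q by s / s makes the relation hold globally *)
  pose G i : {mpoly k[n.+1]} := if i == j then 1 else 'X_i.
  have GE r w : (r \mPo [tuple G i | i < n.+1]).@[w] =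
      r.@[fun i => (\row_i upd w j 1 i) 0 i].
    rewrite meval_comp; apply: meval_eq => i; rewrite mxE /G /upd.
    by case: eqP => _; rewrite ?meval1 ?mevalXU.
  exists ((p * s) \mPo [tuple G i | i < n.+1]), ((q * s) \mPo [tuple G i | i < n.+1]).
  split=> [|w]; rewrite ?GE.
    have [c c0 hc] := pval_is_point (ptP u); rewrite (hc _ _ (dhomogM qe se)).
    have [qu _] := hU _ (ptW u) Uu.
    by rewrite mulf_neq0 ?expf_neq0 // /pval mevalM mulf_neq0.
  have [c c0 hc] := pval_is_point (ptP w).
  rewrite (hc _ _ (dhomogM qe se)) (hc _ _ (dhomogM pe se)) /= -mulrA.
  congr (_ * _); rewrite /pval !mevalM -!/(pval _ _).
  have [->|sw] := eqVneq (pval s (pt w)) 0; first by rewrite !mulr0 mul0r.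
  have [qw ->] := hU _ (ptW w) (sU _ sw).
  by rewrite mulrAC mulrCA divff // mulr1.
exists P => x /WE xj; rewrite -PP /=; congr h.
apply: is_point_inj (ptP _); rewrite (_ : \row_i _ = (coords x 0 j)^-1 *: coords x).
  by apply: is_point_scale (is_point_coords x); rewrite invr_eq0.
apply/rowP => i; rewrite !mxE /upd [RHS]mulrC.
by case: eqP => [->|//]; rewrite divff.
Qed.

(** Homogenize P with powers of x_j. *)
Lemma regular_chart_mpoly (k : fieldType) (m : nat) (j : 'I_m) (P : {mpoly k[m]})
    (W : set (proj k m)) :
  (forall x, W x -> coords x 0 j != 0) ->
  regular_on W (fun x => P.@[fun i => coords x 0 i / coords x 0 j]).
Proof.
move=> Wj x Wx; pose N := msize P.
exists N, (\sum_(a <- msupp P) P@_a *: ('X_[a] * 'X_j ^+ (N - mdeg a))), ('X_j ^+ N).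
exists setT; split=> //.
- rewrite big_seq; apply: rpred_sum => a aP; apply: dhomogZ.
  have /subnKC {2}<- : (mdeg a <= N)%N by apply/ltnW/msize_mdeg_lt.
  apply: dhomogM; first by rewrite dhomogX.
  by rewrite -[X in X.-homog]mul1n; apply: dhomogMn; rewrite dhomogX /= mdeg1.
- by rewrite -[X in X.-homog]mul1n; apply: dhomogMn; rewrite dhomogX /= mdeg1.
- exact: zariski_openT.
move=> y /Wj yj _; have E M : pval ('X_j ^+ M) y = coords y 0 j ^+ M.
  by rewrite /pval rmorphXn /= mevalXU.
rewrite E expf_neq0 //; split=> //.
rewrite /pval raddf_sum /= mulr_suml mevalE big_seq [RHS]big_seq.
apply: eq_bigr => a /msize_mdeg_lt/ltnW aN.
rewrite mevalZ mevalM -/(pval ('X_j ^+ _) y) E mevalX -mulrA; congr (_ * _).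
have {2}<- : (mdeg a + (N - mdeg a))%N = N by apply: subnKC.
rewrite exprD -mulf_div divff ?expf_neq0 // mulr1.
by under [LHS]eq_bigr do rewrite expr_div_n; rewrite prodf_div prodrXr -mdegE.
Qed.

(** * Monomial maps: finiteness and closed image *)

Lemma form_map_coords (k : fieldType) (m r d : nat) (G : 'I_r -> {mpoly k[m]}) f :
  form_map d G f -> forall x, exists2 c, c != 0 &
    forall i, pval (G i) x = c * coords (f x) 0 i.
Proof.
move=> [_ fP] x; have /is_pointP[c c0 /rowP h] := fP x; exists c => // i.
by have := h i; rewrite !mxE.
Qed.

Lemma pval_pure_power (k : fieldType) (m d : nat) (j : 'I_m) (x : proj k m) :
  pval 'X_[U_(j) *+ d] x = coords x 0 j ^+ d.
Proof. by rewrite -mpolyXn /pval rmorphXn /= mevalXU. Qed.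

(** Over the chart where the j-th pure power is nonzero, split each exponent as
m_i = d q_i + r_i with r_i < d.  The monomials in u_i = x_i / x_j with all
exponents less than d generate, and their coefficients are polynomials in the
u_i^d, which are quotients of coordinates of the image. *)
Lemma monomial_map_finite (k : closedFieldType) (n r d : nat)
    (a : 'I_r.+1 -> 'X_{1..n.+1}) (v : 'I_n.+1 -> 'I_r.+1)
    (phi : proj k n.+1 -> proj k r.+1) :
  [pchar k] =i pred0 -> (0 < d)%N -> (forall j, a (v j) = (U_(j) *+ d)%MM) ->
  form_map d (fun i => 'X_[a i]) phi -> zariski_closed (range phi) ->
  finite_morphism setT (range phi) phi.
Proof.
move=> k0 d0 av phiF rc; split.
  by apply: (form_map_morphism phiF) => x _; exists x.
have phiv x : exists2 c, c != 0 &
    forall j, coords x 0 j ^+ d = c * coords (phi x) 0 (v j).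
  have [c c0 h] := form_map_coords phiF x; exists c => // j.
  by rewrite -h av pval_pure_power.
have phi0 x j : (coords (phi x) 0 (v j) != 0) = (coords x 0 j != 0).
  have [c c0 h] := phiv x; have := congr1 (fun t => t == 0) (h j).
  by rewrite expf_eq0 d0 mulf_eq0 (negbTE c0) /= => ->.
move=> y [x _ yE]; have [j xj] := coords_neq0_ex x.
exists [set z | coords z 0 (v j) != 0] => V W.
have WE z : W z <-> coords z 0 j != 0.
  rewrite -phi0; split=> [[_ [_ h]]|zj]; first exact: h.
  by split=> //; split=> //; exists z.
split.
- exact: zariski_open_coord.
- by rewrite -yE /= phi0.
- exact: affine_closed_chart.
- have -> : W = setT `&` [set z | coords z 0 j != 0].
    by rewrite predeqE => z; rewrite WE; split=> [|[]].
  exact/affine_closed_chart/zariski_closedT.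
pose I := {ffun 'I_n.+1 -> 'I_d}.
pose R (i : 'I_#|I|) : I := enum_val i.
pose mon (t : I) : {mpoly k[n.+1]} := \prod_l 'X_l ^+ t l.
exists #|I|, (fun i z => (mon (R i)).@[fun l => coords z 0 l / coords z 0 j]).
split=> [i|h hreg]; first by apply: regular_chart_mpoly => z /WE.
have [P hP] := regular_chart k0 WE hreg.
pose rem (m : 'X_{1..n.+1}) : I := [ffun l => Ordinal (ltn_pmod (m l) d0)].
pose C (t : I) : {mpoly k[r.+1]} := \sum_(m <- msupp P | rem m == t)
  P@_m *: \prod_l 'X_(v l) ^+ (m l %/ d).
exists (fun i z => (C (R i)).@[fun l => coords z 0 l / coords z 0 (v j)]).
split=> [i|z Wz]; first by apply: regular_chart_mpoly => z [].
rewrite (hP z Wz) {hP hreg}.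
pose u l := coords z 0 l / coords z 0 j.
rewrite (eq_bigr (fun i : 'I_#|I| => (fun t : I =>
  (\sum_(m <- msupp P | rem m == t) P@_m * \prod_l (u l ^+ d) ^+ (m l %/ d)) *
  \prod_l u l ^+ t l) (R i))); last first.
  move=> i _; rewrite /C /mon raddf_sum /= meval_prod; congr (_ * _); last first.
    by apply: eq_bigr => l _; rewrite rmorphXn /= mevalXU.
  apply: eq_bigr => m _; rewrite mevalZ meval_prod; congr (_ * _).
  apply: eq_bigr => l _; rewrite rmorphXn /= mevalXU; congr (_ ^+ _).
  have [c c0 hc] := phiv z; rewrite /u expr_div_n !hc.
  by rewrite -mulf_div divff // mul1r.
rewrite -(big_enum_val (fun t : I =>
  (\sum_(m <- msupp P | rem m == t) P@_m * \prod_l (u l ^+ d) ^+ (m l %/ d)) *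
  \prod_l u l ^+ t l)) /=.
rewrite mevalE.
under [RHS]eq_bigr do rewrite big_distrl /= big_mkcond /=.
rewrite exchange_big /=; apply: eq_bigr => m _.
rewrite -big_mkcond /= (big_pred1 (rem m)) // -mulrA; congr (_ * _).
rewrite -big_split /=; apply: eq_bigr => l _.
by rewrite ffunE /= -exprM -exprD mulnC -divn_eq.
Qed.

Lemma closed_root_exists (k : closedFieldType) (d : nat) (c : k) :
  (0 < d)%N -> exists z, z ^+ d = c.
Proof.
move=> d0; have sz : size ('X^d - c%:P) != 1%N by rewrite size_XnsubC // eqSS -lt0n.
have [z] := closed_rootP _ sz.
rewrite /root hornerD hornerN hornerXn hornerC subr_eq0 => /eqP.
by exists z.
Qed.

(** The image is the set of zeros y of all binomials X^u - X^w in the kernel of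
the substitution y_i := x^(a_i).  For such a y, any z with z_j^d equal to the
coordinate of y at the pure power x_j^d satisfies (z^(a_i))^d = y_i^d, and
the roots of unity y_i / z^(a_i), for y_i <> 0, satisfy the relations needed
to write them as the values of the monomials at a point of order d of the
torus. *)
Lemma monomial_map_closed (k : closedFieldType) (n r d : nat) (e : k)
    (a : 'I_r -> 'X_{1..n.+1}) (v : 'I_n.+1 -> 'I_r)
    (phi : proj k n.+1 -> proj k r) :
  [pchar k] =i pred0 -> d.-primitive_root e ->
  (forall j, a (v j) = (U_(j) *+ d)%MM) -> (forall i, mdeg (a i) = d) ->
  form_map d (fun i => 'X_[a i]) phi -> zariski_closed (range phi).
Proof.
move=> k0 ep av ad phiF; have d0 := prim_order_gt0 ep.
exists [set q | exists u w : 'X_{1..r}, [/\ mdeg u = mdeg w,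
  forall j, (\sum_i u i * a i j = \sum_i w i * a i j)%N & q = 'X_[u] - 'X_[w]]].
split=> [_ [u [w [uw _ ->]]]|].
  by exists (mdeg u); rewrite dhomogD ?dhomogN ?dhomogX //= uw.
rewrite predeqE => y; split=> [[x _ <-] _ [u [w [uw aw ->]]]|yP].
  have [c c0 h] := form_map_pval phiF x.
  apply: (mulfI (expf_neq0 (mdeg u) c0)); rewrite mulr0 -h; last first.
    by rewrite dhomogD ?dhomogN ?dhomogX //= uw.
  have cE (t : 'X_{1..r}) : ('X_[t] \mPo [tuple 'X_[a j] | j < r] : {mpoly k[n.+1]}) =
      'X_[\sum_i (a i *+ t i)].
    by rewrite comp_mpolyX -mprodXnE; apply: eq_bigr => i _; rewrite tnth_mktuple.
  rewrite comp_mpolyB !cE (_ : (\sum_i (a i *+ u i))%MM = (\sum_i (a i *+ w i))%MM).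
    by rewrite subrr /pval meval0.
  apply/mnmP => j; rewrite !mnm_sumE.
  under eq_bigr do rewrite mulmnE mulnC; rewrite aw.
  by apply: eq_bigr => i _; rewrite mulmnE mulnC.
(* conversely, a preimage of a zero y of the binomials *)
pose Y i := coords y 0 i.
have /boolp.choice[z zP] : forall j, exists z, z ^+ d = Y (v j).
  by move=> j; apply: closed_root_exists.
pose Z i := \prod_j z j ^+ a i j.
have rel (f : 'I_r -> nat) : (forall j, d %| \sum_i f i * a i j)%N ->
    \prod_i Y i ^+ f i = \prod_i Z i ^+ f i.
  move=> fd; pose q j := ((\sum_i f i * a i j) %/ d)%N.
  have qE j : (q j * d = \sum_i f i * a i j)%N by rewrite divnK.
  pose u := [multinom f i | i < r]; pose w : 'X_{1..r} := (\sum_j (U_(v j) *+ q j))%MM.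
  have pu : pval 'X_[u] y = \prod_i Y i ^+ f i.
    by rewrite /pval mevalX; apply: eq_bigr => i _; rewrite mnmE.
  have pw : pval 'X_[w] y = \prod_j Y (v j) ^+ q j.
    rewrite /pval -mprodXnE meval_prod; apply: eq_bigr => i _.
    by rewrite rmorphXn /= mevalXU.
  have : pval ('X_[u] - 'X_[w]) y = 0.
    apply: yP; exists u, w; split=> //.
      have mw : mdeg w = (\sum_j q j)%N.
        by rewrite mdeg_sum; apply: eq_bigr => j _; rewrite mdegMn mdeg1 mul1n.
      apply/eqP; rewrite mw -(eqn_pmul2r d0) [X in _ == X]big_distrl /=.
      under [X in _ == X]eq_bigr do rewrite qE.
      rewrite exchange_big mdegE big_distrl /=; apply/eqP/eq_bigr => i _.
      by rewrite -big_distrr /= -mdegE ad mnmE.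
    move=> j; under eq_bigr do rewrite mnmE.
    rewrite -qE; under [RHS]eq_bigr do rewrite mnm_sumE big_distrl /=.
    rewrite exchange_big /= (bigD1 j) //= [X in (_ + X)%N]big1 ?addn0.
      rewrite (bigD1 (v j)) //= big1 ?addn0.
        by rewrite mulmnE mnm1E eqxx mul1n av mulmnE mnm1E eqxx mul1n.
      by move=> i iv; rewrite mulmnE mnm1E eq_sym (negbTE iv) !mul0n.
    move=> l lj; apply: big1 => i _; rewrite mulmnE mnm1E.
    case: eqP => [<-|_]; last by rewrite !mul0n.
    by rewrite av mulmnE mnm1E (negbTE lj) mul0n muln0.
  rewrite /pval mevalB -!/(pval _ _) pu pw => /eqP; rewrite subr_eq0 => /eqP->.
  under [RHS]eq_bigr do rewrite /Z -prodrXl.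
  rewrite exchange_big /=; apply: eq_bigr => j _.
  under [RHS]eq_bigr do rewrite -exprM mulnC.
  by rewrite prodrXr -qE mulnC exprM zP.
have YZd i : Y i ^+ d = Z i ^+ d.
  have := rel (fun l => if l == i then d else 0)%N.
  rewrite (bigD1 i) //= eqxx big1 ?mulr1; last by move=> l /negbTE->.
  rewrite (bigD1 i) //= eqxx big1 ?mulr1; last by move=> l /negbTE->.
  by apply=> s; apply: dvdn_sum => l _; case: eqP => _; rewrite ?mul0n ?dvdn_mulr.
have YZ0 i : (Z i == 0) = (Y i == 0).
  by have := congr1 (fun t => t == 0) (YZd i); rewrite !expf_eq0 d0.
have [|w wP] := @root_unity_system k d e 'I_r 'I_n.+1
    (fun i j => if Y i == 0 then 0%N else a i j)
    (fun i => if Y i == 0 then 1 else Y i / Z i) k0 ep.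
  move=> f fd; pose f' i := if Y i == 0 then 0%N else f i.
  have E : \prod_i Y i ^+ f' i = \prod_i Z i ^+ f' i.
    apply: rel => j; have := fd j; congr (_ %| _)%N; apply: eq_bigr => i _.
    by rewrite /f'; case: eqP; rewrite ?muln0.
  have E0 : \prod_i Z i ^+ f' i != 0.
    apply/prodf_neq0 => i _; rewrite /f'; have [Yi|Yi] := eqVneq (Y i) 0.
      by rewrite expr0 oner_neq0.
    by rewrite expf_neq0 // YZ0.
  transitivity (\prod_i Y i ^+ f' i / \prod_i Z i ^+ f' i); last by rewrite E divff.
  rewrite -prodf_div; apply: eq_bigr => i _; rewrite /f'; case: eqP => _.
    by rewrite expr1n divr1.
  by rewrite expr_div_n.
pose x j := e ^+ w j * z j.
have xP i : \prod_j x j ^+ a i j = Y i.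
  under eq_bigr do rewrite exprMn -exprM.
  rewrite big_split /= -/(Z i); have := wP i; have [Yi|Yi] := eqVneq (Y i) 0.
    by have := YZ0 i; rewrite Yi eqxx => /eqP->; rewrite mulr0.
  by move=> ->; rewrite divfK // YZ0.
have x0 : \row_j x j != 0.
  have /eqP := coords_neq0 y; apply: contra_not_neq => /rowP x0.
  apply/rowP => i; rewrite mxE -/(Y i) -xP.
  have /existsP[j aj] : [exists j, a i j != 0%N].
    rewrite -negb_forall; apply: contraL d0 => /forallP a0.
    by rewrite -(ad i) mdegE big1 // => j _; apply/eqP.
  by rewrite (bigD1 j) //=; have := x0 j; rewrite !mxE => ->; rewrite expr0n (negbTE aj) mul0r.
have [p pP] := is_point_exists x0; exists p => //.
have [c c0 hc] := pval_is_point pP.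
have hp := phiF.2 p.
apply: is_point_inj hp _.
have -> : \row_j pval 'X_[a j] p = (c ^+ d)^-1 *: coords y.
  apply/rowP => i; rewrite !mxE; apply: (mulfI (expf_neq0 d c0)).
  have ha : ('X_[a i] : {mpoly k[n.+1]}) \is d.-homog by rewrite dhomogX /= ad.
  rewrite -(hc _ _ ha) mulVKf ?expf_neq0 // mevalX -/(Y i) -xP.
  by apply: eq_bigr => j _; rewrite mxE.
by apply: is_point_scale (is_point_coords y); rewrite invr_eq0 expf_neq0.
Qed.

(** * Monomial ideals: the artinian property and the failure of WLP *)

Lemma ideal_gen_ideal (A : comNzRingType) (r : nat) (F : 'I_r -> A) :
  is_ideal (ideal_gen F).
Proof.
split=> [|p q [c ->] [c' ->]|b p [c ->]].
- by exists (fun=> 0); rewrite big1 // => i _; rewrite mul0r.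
- exists (fun i => c i + c' i); rewrite -big_split /=.
  by apply: eq_bigr => i _; rewrite mulrDl.
- exists (fun i => b * c i); rewrite mulr_sumr.
  by apply: eq_bigr => i _; rewrite mulrA.
Qed.

Lemma ideal_sum (A : comNzRingType) (J : set A) (I : Type) (s : seq I) (F : I -> A) :
  is_ideal J -> (forall i, J (F i)) -> J (\sum_(i <- s) F i).
Proof. by move=> [J0 JD _] JF; elim/big_rec: _ => // i x _; apply: JD. Qed.

Lemma monomial_idealP (k : fieldType) (n mu : nat) (m : 'I_mu -> 'X_{1..n})
    (p : {mpoly k[n]}) :
  ideal_gen (fun i => 'X_[m i]) p <->
  forall a, a \in msupp p -> exists i, (m i <= a)%MM.
Proof.
split=> [[c ->] a|h].
  rewrite mcoeff_msupp raddf_sum /= => sa.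
  have /existsP[i ia] : [exists i, (c i * 'X_[m i])@_a != 0].
    apply: contraNT sa; rewrite negb_exists => /forallP z.
    by rewrite big1 // => i _; have := z i; rewrite negbK => /eqP.
  exists i; move: ia; rewrite -mcoeff_msupp (perm_mem (msuppMX _ _)).
  by case/mapP => b _ ->; apply: lem_addr.
have Ip := ideal_gen_ideal (fun i => 'X_[m i] : {mpoly k[n]}).
rewrite [p]mpolyE big_seq big_mkcond; apply: ideal_sum => // a /=.
case: ifP => [/h[i ia]|_]; last by case: Ip.
rewrite -(submK ia) mpolyXD -mul_mpolyC mulrA; case: Ip => _ _; apply.
exists (fun j => (j == i)%:R); rewrite (bigD1 i) //= eqxx mul1r big1 ?addr0 //.
by move=> j /negbTE->; rewrite mul0r.
Qed.

(** Every subspace of a space of row vectors is a row space: choose a matrix of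
maximal rank among those with rows in it. *)
Lemma subspace_mx (k : fieldType) (N : nat) (S : set 'rV[k]_N) :
  S 0 -> (forall c u v, S u -> S v -> S (c *: u + v)) ->
  exists A : 'M[k]_N, forall v, S v <-> (v <= A)%MS.
Proof.
move=> S0 SD.
pose P r := `[< exists A : 'M[k]_N, (forall v, (v <= A)%MS -> S v) /\ \rank A = r >].
have exP : exists r, P r.
  exists 0%N; apply/asboolP; exists 0; split; last exact: mxrank0.
  by move=> v; rewrite submx0 => /eqP->.
have leP r : P r -> (r <= N)%N.
  by move=> /asboolP[A [_ <-]]; apply: rank_leq_row.
case: (ex_maxnP exP leP) => _ /asboolP[A [AS <-]] maxA.
exists A => v; split=> [Sv|]; last exact: AS.
apply: contraT => vA.
have : P (\rank (A + v)%MS).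
  apply/asboolP; exists (A + v)%MS; split=> // w /sub_addsmxP[[u1 u2] /= ->].
  rewrite [u2]mx11_scalar mul_scalar_mx addrC; apply: SD => //.
  by apply: AS; apply: submxMl.
move/maxA; rewrite leqNgt ltn_neqAle mxrankS ?addsmxSl // andbT negbK.
rewrite (mxrank_leqif_sup (addsmxSl _ _)).2 => h.
by move: vA; rewrite (submx_trans (addsmxSr A v) h).
Qed.

Lemma decreasing_subspaces (k : fieldType) (N : nat) (S : nat -> set 'rV[k]_N) :
  (forall i, S i 0) -> (forall i c u v, S i u -> S i v -> S i (c *: u + v)) ->
  (forall i, S i.+1 `<=` S i) ->
  exists i0, forall i, (i0 <= i)%N -> S i0 `<=` S i.
Proof.
move=> S0 SD Sdec.
have /boolp.choice[A AP] : forall i, exists A : 'M[k]_N, forall v, S i v <-> (v <= A)%MS.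
  by move=> i; apply: subspace_mx; [apply: S0 | apply: SD].
have dec i j : (i <= j)%N -> S j `<=` S i.
  elim: j => [|j IH]; first by rewrite leqn0 => /eqP->.
  rewrite leq_eqVlt => /predU1P[-> //|]; rewrite ltnS => /IH ij v /Sdec; exact: ij.
have exP : exists r, `[< exists i, \rank (A i) = r >].
  by exists (\rank (A 0)); apply/asboolP; exists 0%N.
case: (ex_minnP exP) => _ /asboolP[i0 <-] mini; exists i0 => i ii v /AP vA.
have Ai : (A i <= A i0)%MS.
  by apply/rV_subP => w /AP/(dec _ _ ii)/AP.
apply/AP/(submx_trans vA); rewrite -(mxrank_leqif_sup Ai).2 eqn_leq mxrankS //=.
by apply: mini; apply/asboolP; exists i.
Qed.

(** All monomials of degree greater than (n + 1) d lie in the ideal, so an ideal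
containing it is determined by its elements of degree at most (n + 1) d, that
is, by a subspace of a fixed finite-dimensional space. *)
Lemma artinian_monomial (k : fieldType) (n d mu : nat) (m : 'I_mu -> 'X_{1..n.+1})
    (v : 'I_n.+1 -> 'I_mu) :
  (forall j, m (v j) = (U_(j) *+ d)%MM) ->
  artinian (ideal_gen (fun i => 'X_[m i] : {mpoly k[n.+1]})).
Proof.
move=> mv J Jid IJ Jdec; pose D := (n.+1 * d).+1.
have high (p : {mpoly k[n.+1]}) i :
    (forall a, a \in msupp p -> (D <= mdeg a)%N) -> J i p.
  move=> hp; apply: IJ; apply/monomial_idealP => a /hp Da.
  have /existsP[j aj] : [exists j, d <= a j]%N.
    apply: contraLR Da; rewrite negb_exists => /forallP aj.
    rewrite -leqNgt mdegE; have <- : (\sum_(j < n.+1) d = n.+1 * d)%N.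
    by rewrite sum_nat_const card_ord.
    by apply: leq_sum => j _; rewrite ltnW // ltnNge.
  exists (v j); rewrite mv; apply/mnm_lepP => l; rewrite mulmnE mnm1E.
  by case: eqP => [<-|_]; rewrite ?mul1n ?mul0n.
pose N := #|{: 'X_{1..n.+1 < D}}|.
pose poly_of (u : 'rV[k]_N) : {mpoly k[n.+1]} :=
  \sum_(a : 'X_{1..n.+1 < D}) u 0 (enum_rank a) *: 'X_[a].
have poly_ofD c u w : poly_of (c *: u + w) = c%:MP * poly_of u + poly_of w.
  rewrite /poly_of mulr_sumr -big_split /=; apply: eq_bigr => a _.
  by rewrite !mxE scalerDl mul_mpolyC scalerA.
pose low (p : {mpoly k[n.+1]}) : 'rV[k]_N := \row_i p@_(enum_val i : 'X_{1..n.+1 < D}).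
have lowP p i : J i (p - poly_of (low p)).
  apply: high => a; rewrite mcoeff_msupp; apply: contraR; rewrite -ltnNge => aD.
  rewrite mcoeffB /poly_of (eq_bigr (fun a : 'X_{1..n.+1 < D} => p@_a *: 'X_[a])).
    by rewrite (mcoeff_mpoly (fun a => p@_a) aD) subrr.
  by move=> b _; rewrite mxE enum_rankK.
have lowJ p i : J i p <-> J i (poly_of (low p)).
  have [J0 JD JM] := Jid i; have lp := lowP p i; split=> Jp.
    have -> : poly_of (low p) = p + (-1) * (p - poly_of (low p)).
      by rewrite mulN1r opprB addrC subrK.
    by apply: JD => //; apply: JM.
  by rewrite -(subrK (poly_of (low p)) p); apply: JD.
have [|||i0 hi0] := @decreasing_subspaces k N (fun i => [set u | J i (poly_of u)]).
- move=> i /=; rewrite /poly_of big1; first by case: (Jid i).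
  by move=> a _; rewrite mxE scale0r.
- move=> i c u w /= Ju Jw; rewrite poly_ofD; have [_ JD JM] := Jid i.
  by apply: JD => //; apply: JM.
- by move=> i u /=; apply: Jdec.
exists i0 => i ii; rewrite predeqE => p; split; last first.
  by move=> Jp; apply/(lowJ p i).2/(hi0 i ii)/(lowJ p i0).1.
elim: i ii => [|i IH]; first by rewrite leqn0 => /eqP->.
by rewrite leq_eqVlt => /predU1P[-> //|]; rewrite ltnS => /IH h /Jdec.
Qed.

Lemma surjective_injective (k : fieldType) (V W : vectType k) (f : {linear V -> W}) :
  (dim V <= dim W)%N -> (forall w, exists v, f v = w) ->
  forall v, f v = 0 -> v = 0.
Proof.
move=> VW surj v fv; pose F := linfun f.
have lF : limg F = fullv.
  apply/eqP; rewrite eqEsubv subvf; apply/subvP => w _.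
  by have [u <-] := surj w; rewrite -[f u](lfunE f) memv_img // memvf.
have := limg_ker_dim F fullv; rewrite lF !dimvf capfv => h.
have /eqP : (\dim (lker F) = 0)%N.
  by apply/eqP; rewrite -leqn0 -(leq_add2r (dim W)) h.
rewrite dimv_eq0 => /eqP ker0.
have : v \in lker F by rewrite memv_ker lfunE fv.
by rewrite ker0 memv0 => /eqP.
Qed.

(** With dim R_d = C(n + d, n): a set of C(n + d - 1, n - 1) forms fills exactly
the gap between the dimensions of R_(d-1) and R_d. *)
Lemma dim_count n d : (0 < n)%N -> (0 < d)%N ->
  ('C(d - 1 + n, d - 1) + 'C(n + d - 1, n - 1) = 'C(d + n, d))%N.
Proof.
case: n d => [|n] [|d] // _ _; rewrite !subn1 /= addSn binS addnC; congr (_ + _)%N.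
rewrite !addnS addnC -(@bin_sub (d + n).+1 d.+1) ?ltnS ?leq_addr //.
by rewrite subSS addKn.
Qed.

(** The elements of degree d of the ideal are the linear combinations of the m_i.
So surjectivity of the multiplication by L modulo the ideal is surjectivity of
(p, c) |-> L p + sum_i c_i m_i onto the forms of degree d.  By the bound on mu
this map would then be injective, contrary to the element p provided by the
hypothesis. *)
Lemma fails_WLP_dim (k : fieldType) (n d mu : nat) (m : 'I_mu -> 'X_{1..n.+1}) :
  (0 < n)%N -> (0 < d)%N -> injective m -> (forall i, mdeg (m i) = d) ->
  (mu <= 'C(n + d - 1, n - 1))%N ->
  (forall L : {mpoly k[n.+1]}, L \is 1.-homog -> exists p : {mpoly k[n.+1]},
     [/\ p \is (d - 1).-homog, p != 0 & ideal_gen (fun i => 'X_[m i]) (L * p)]) ->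
  fails_WLP (ideal_gen (fun i => 'X_[m i] : {mpoly k[n.+1]})) (d - 1).
Proof.
move=> n0 d0 m_inj md mu_le ker L L1 [inj|surj]; have [p0 [p0h p00 Lp0]] := ker L L1.
  have /monomial_idealP/(_ _ (mlead_supp p00))[i] := inj _ p0h Lp0.
  move=> /mnm_lepP le; have : (mdeg (m i) <= mdeg (mlead p0))%N.
    by rewrite !mdegE; apply: leq_sum => j _; apply: le.
  rewrite md (dhomog_mf p0h (mlead_supp p00)).
  by rewrite subn1 leqNgt ltn_predL d0.
have d1 : (d - 1).+1 = d by rewrite subn1 prednK.
have mem_span (q : {mpoly k[n.+1]}) : q \is d.-homog ->
    ideal_gen (fun i => 'X_[m i]) q -> q = \sum_i q@_(m i) *: 'X_[m i].
  move=> qh /monomial_idealP qI; apply/mpolyP => a; rewrite raddf_sum /=.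
  have [aq|aq] := boolP (a \in msupp q); last first.
    rewrite memN_msupp_eq0 // big1 // => i _; rewrite mcoeffZ mcoeffX.
    by case: eqP => [->|_]; rewrite ?mulr0 // (memN_msupp_eq0 aq) mul0r.
  have [i ia] := qI _ aq.
  have {ia} <- : m i = a.
    rewrite -[RHS](submK ia); have /eqP : mdeg (a - m i)%MM = 0%N.
      have := mdegD (a - m i) (m i); rewrite submK // md (dhomog_mf qh aq).
      by move/eqP; rewrite -{1}[d]add0n eqn_add2r => /eqP.
    by rewrite mdeg_eq0 => /eqP->; rewrite add0m.
  rewrite (bigD1 i) //= mcoeffZ mcoeffX eqxx mulr1 big1 ?addr0 // => j ji.
  by rewrite mcoeffZ mcoeffX (inj_eq m_inj) (negbTE ji) mulr0.
pose psi0 (pc : dhomog n.+1 k (d - 1) * 'rV[k]_mu) : {mpoly k[n.+1]} :=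
  L * val pc.1 + \sum_i pc.2 0 i *: 'X_[m i].
have psi_h pc : psi0 pc \is d.-homog.
  apply: dhomogD.
    by have := dhomogM L1 (dhomog_is_dhomog pc.1); rewrite subnKC.
  by apply: rpred_sum => i _; apply: dhomogZ; rewrite dhomogX /= md.
pose psi pc := DHomog (psi_h pc).
have psi_lin : linear psi.
  move=> c u w; apply: val_inj => /=; rewrite /psi0 /= mulrDr -scalerAr scalerDr.
  rewrite addrACA; congr (_ + _); rewrite scaler_sumr -big_split /=.
  by apply: eq_bigr => i _; rewrite !mxE scalerDl scalerA.
pose psiL := GRing.isLinear.Build _ _ _ _ psi psi_lin.
pose psif : {linear _ -> _} := HB.pack psi psiL.
have dims : (dim (dhomog n.+1 k (d - 1) * 'rV[k]_mu)%type <= dim (dhomog n.+1 k d))%N.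
  have -> : dim (dhomog n.+1 k (d - 1) * 'rV[k]_mu)%type =
    ('C(d - 1 + n, d - 1) + 1 * mu)%N by [].
  have -> : dim (dhomog n.+1 k d) = 'C(d + n, d) by [].
  by rewrite mul1n -(dim_count n0 d0) leq_add2l.
have psi_surj w : exists v, psif v = w.
  have wh : val w \is (d - 1).+1.-homog by rewrite d1; apply: dhomog_is_dhomog.
  have [p ph wI] := surj _ wh.
  have h : val w - L * p \is d.-homog.
    have := dhomogM L1 ph; rewrite subnKC // => Lp.
    by apply: rpredB Lp; apply: dhomog_is_dhomog.
  exists (DHomog ph, \row_i (val w - L * p)@_(m i)); apply: val_inj => /=.
  rewrite /psi0 /=; under eq_bigr do rewrite mxE.
  by rewrite -(mem_span _ h wI) addrC subrK.
have Lp0h : L * p0 \is d.-homog by have := dhomogM L1 p0h; rewrite subnKC.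
(* the coefficients of L p0 on the m_i, with opposite sign, complete p0 to an
   element of the kernel *)
pose w0 := (DHomog p0h, - \row_i (L * p0)@_(m i)) :
  dhomog n.+1 k (d - 1) * 'rV[k]_mu.
have : psif w0 = 0.
  apply: val_inj => /=; rewrite /psi0 /=; apply/eqP; rewrite addr_eq0.
  rewrite -sumrN {1}(mem_span _ Lp0h Lp0); apply/eqP/eq_bigr => i _.
  by rewrite !mxE scaleNr opprK.
move=> /(surjective_injective dims psi_surj)/(congr1 (fun t => val t.1)) /= E.
by move/eqP: p00; apply.
Qed.

(** * Diagonal matrices: invariant norms, scalars and stabilizers *)

Lemma mcoeff_diag_act (k : fieldType) (m : nat) (c : 'rV[k]_m) (p : {mpoly k[m]})
    (a : 'X_{1..m}) :
  (diag_act c p)@_a = (\prod_i c 0 i ^+ a i) * p@_a.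
Proof.
rewrite /diag_act comp_mpolyEX raddf_sum /=.
have mon (b : 'X_{1..m}) : 'X_[b] \mPo [tuple c 0 i *: 'X_i | i < m] =
    (\prod_i c 0 i ^+ b i) *: 'X_[b] :> {mpoly k[m]}.
  rewrite comp_mpolyX (mpolyXE_id k b) -scaler_prod.
  by apply: eq_bigr => i _; rewrite tnth_mktuple exprZn.
under eq_bigr do rewrite mon mcoeffZ mcoeffZ mcoeffX.
have [ap|ap] := boolP (a \in msupp p).
  rewrite (bigD1_seq a) ?msupp_uniq //= eqxx mulr1 mulrC.
  rewrite [X in _ + X]big1 ?addr0 // => b ba.
  by rewrite (negbTE ba) !mulr0.
rewrite (memN_msupp_eq0 ap) mulr0 big_seq big1 // => b bp.
by case: eqP => [ba|]; [rewrite -ba bp in ap | rewrite !mulr0].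
Qed.

(** Let L_t be the t-th conjugate of L.  The norm L_0 L_1 ... L_(d-1) is invariant,
hence a combination of invariant monomials of degree d, and L = L_0 divides it.
For L = 0 any monomial of degree d - 1 will do. *)
Lemma norm_kernel (k : fieldType) (n d : nat) (c : 'I_n.+1 -> k)
    (mu : nat) (m : 'I_mu -> 'X_{1..n.+1}) :
  (0 < d)%N -> (forall j, c j ^+ d = 1) ->
  (forall a : 'X_{1..n.+1}, mdeg a = d -> \prod_j c j ^+ a j = 1 ->
     exists i, m i = a) ->
  forall L : {mpoly k[n.+1]}, L \is 1.-homog -> exists p : {mpoly k[n.+1]},
     [/\ p \is (d - 1).-homog, p != 0 & ideal_gen (fun i => 'X_[m i]) (L * p)].
Proof.
move=> d0 cd mP L L1; have [->|L0] := eqVneq L 0.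
  exists 'X_[U_(ord0) *+ (d - 1)]; split.
  - by rewrite dhomogX /= mdegMn mdeg1 mul1n.
  - by rewrite -msize_poly_eq0 msizeX.
  by rewrite mul0r; case: (ideal_gen_ideal (fun i => 'X_[m i] : {mpoly k[n.+1]})).
have c0 j : c j != 0 := unity_neq0 d0 (cd j).
pose conj t : {mpoly k[n.+1]} := diag_act (\row_j c j ^+ t) L.
have conjE t a : (conj t)@_a = (\prod_j c j ^+ a j) ^+ t * L@_a.
  rewrite mcoeff_diag_act; congr (_ * _); rewrite -prodrXl.
  by apply: eq_bigr => j _; rewrite mxE exprAC.
have conj0 : conj 0 = L by apply/mpolyP => a; rewrite conjE expr0 mul1r.
have conj_d : conj d = L.
  apply/mpolyP => a; rewrite conjE -prodrXl big1 ?mul1r // => j _.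
  by rewrite exprAC cd expr1n.
have conjh t : conj t \is 1.-homog.
  apply/dhomogP => a; rewrite mcoeff_msupp conjE mulf_eq0 negb_or => /andP[_].
  by rewrite -mcoeff_msupp; apply: dhomog_mf.
have conj_neq0 t : conj t != 0.
  apply: contraNneq L0 => e0; apply/eqP/mpolyP => a; rewrite mcoeff0.
  have /eqP := conjE t a; rewrite e0 mcoeff0 eq_sym mulf_eq0 expf_eq0.
  have /negbTE-> : \prod_j c j ^+ a j != 0.
    by apply/prodf_neq0 => j _; rewrite expf_neq0.
  by rewrite andbF => /eqP.
have conjS t : diag_act (\row_j c j) (conj t) = conj t.+1.
  apply/mpolyP => a; rewrite mcoeff_diag_act !conjE exprS mulrA; congr (_ * _ * _).
  by apply: eq_bigr => j _; rewrite mxE.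
exists (\prod_(t < d - 1) conj t.+1); split.
- by have := dhomog_prodf (index_enum 'I_(d - 1)) (fun t => conjh t.+1);
     rewrite sum1_card card_ord.
- by apply/prodf_neq0 => t _.
have d1 : (d - 1).+1 = d by rewrite subn1 prednK.
have normE : L * \prod_(t < d - 1) conj t.+1 = \prod_(t < (d - 1).+1) conj t.
  by rewrite big_ord_recl /= conj0.
have norm_inv : diag_act (\row_j c j) (\prod_(t < (d - 1).+1) conj t) =
    \prod_(t < (d - 1).+1) conj t.
  rewrite /diag_act rmorph_prod /=; under eq_bigr do rewrite -/(diag_act _ _) conjS.
  by rewrite big_ord_recr big_ord_recl /= d1 conj_d conj0 mulrC.
rewrite normE; apply/monomial_idealP => a ap.
suff [i <-] : exists i, m i = a by exists i; apply: lepm_refl.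
apply: mP.
  have := dhomog_prodf (index_enum 'I_((d - 1).+1)) (fun t => conjh t).
  by rewrite sum1_card card_ord => /dhomog_mf/(_ a ap) ->.
have := congr1 (mcoeff a) norm_inv; rewrite mcoeff_diag_act.
move/eqP; rewrite -subr_eq0 -[X in _ - X]mul1r -mulrBl mulf_eq0.
rewrite -[X in _ || X]negbK -mcoeff_msupp ap orbF subr_eq0 => /eqP h.
by rewrite -[RHS]h; apply: eq_bigr => j _; rewrite mxE.
Qed.


(** An induction principle for groups generated by diagonal matrices of exponent
d: inverses are powers, so that a property stable under products is stable
under inverses. *)
Lemma GL_generated_diag (k : fieldType) (N d : nat) (S : set 'M[k]_N)
    (R : set ('I_N -> k)) (A : 'M[k]_N) :
  (0 < d)%N -> (forall B, S B -> exists2 c, R c & B = diag_mx (\row_j c j)) ->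
  R (fun=> 1) -> (forall b c, R b -> R c -> R (fun j => b j * c j)) ->
  (forall c j, R c -> c j ^+ d = 1) ->
  GL_generated S A -> exists2 c, R c & A = diag_mx (\row_j c j).
Proof.
move=> d0 SR R1 RM Rd; elim=> [//||B C _ [b Rb ->] _ [c Rc ->]|B _ [b Rb ->]].
- exists (fun=> 1) => //; rewrite -[LHS]diag_const_mx; congr diag_mx.
  by apply/rowP => j; rewrite !mxE.
- exists (fun j => b j * c j); first exact: RM.
  by rewrite mulmx_diag; congr diag_mx; apply/rowP => j; rewrite !mxE.
have Rpow i : R (fun j => b j ^+ i).
  elim: i => [|i IH]; first exact: R1.
  by have := RM _ _ Rb IH; congr R; apply: funext => j; rewrite exprS.
exists (fun j => b j ^+ d.-1); first exact: Rpow.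
have inv : diag_mx (\row_j b j) *m diag_mx (\row_j b j ^+ d.-1) = 1%:M.
  rewrite mulmx_diag -diag_const_mx; congr diag_mx; apply/rowP => j.
  by rewrite !mxE -exprS prednK // Rd.
have [uB _] := mulmx1_unit inv.
by rewrite -[LHS]mulmx1 -inv mulKmx.
Qed.

(** The group generated by diag(c) and e consists of the d^2 products
diag(c)^x e^y with x, y < d.  As it has d^2 elements these are distinct, and a
scalar diag(c)^i = e^l forces i = 0 modulo d. *)
Lemma scalar_power_dvd (k : fieldType) (N d : nat) (e : k) (c : 'I_N -> k) (lam : k)
    (i : nat) :
  d.-primitive_root e -> (forall j, c j ^+ d = 1) ->
  has_order (GL_generated [set diag_mx (\row_j c j); e%:M]) (d ^ 2)%N ->
  (0 < N)%N -> (forall j, c j ^+ i = lam) -> (d %| i)%N.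
Proof.
move=> ep cd [s [us ss sP]] N0 ci; have d0 := prim_order_gt0 ep.
have ed := prim_expr_order ep.
pose D (p : 'I_d * 'I_d) : 'M[k]_N := diag_mx (\row_j (c j ^+ p.1 * e ^+ p.2)).
have sub : {subset s <= codom D}.
  move=> A /sP; case/(GL_generated_diag (d := d) (R := [set b | exists i l : nat,
      forall j, b j = c j ^+ i * e ^+ l])) => //.
  - move=> B [->|->].
      by exists c => //; exists 1%N, 0%N => j; rewrite mulr1.
    exists (fun=> e); first by exists 0%N, 1%N => j; rewrite mul1r.
    by rewrite -diag_const_mx; congr diag_mx; apply/rowP => j; rewrite !mxE.
  - by exists 0%N, 0%N => j; rewrite mulr1.
  - move=> b b' [x [y bE]] [x' [y' b'E]]; exists (x + x')%N, (y + y')%N => j.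
    by rewrite bE b'E !exprD mulrACA.
  - by move=> b j [x [y ->]]; rewrite exprMn (exprAC _ x) (exprAC _ y) cd ed !expr1n mulr1.
  move=> b [x [y bE]] ->; apply/codomP.
  exists (Ordinal (ltn_pmod x d0), Ordinal (ltn_pmod y d0)); congr diag_mx.
  by apply/rowP => j; rewrite !mxE bE /= !expr_mod.
have Dinj : injective D.
  apply/injectiveP; rewrite /injectiveb /dinjectiveb -/(codom D).
  apply: leq_size_uniq us sub _; rewrite size_map -cardE ss.
  by rewrite card_prod card_ord mulnn.
have lamd : lam ^+ d = 1 by rewrite -(ci (Ordinal N0)) exprAC cd expr1n.
have [l lamE] := prim_rootP ep lamd.
have : D (Ordinal (ltn_pmod i d0), Ordinal d0) = D (Ordinal d0, l).
  congr diag_mx; apply/rowP => j; rewrite !mxE /= expr_mod // ci mulr1 mul1r.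
  exact: lamE.
by move=> /Dinj[] /eqP.
Qed.

(** By [root_unity_system] in one unknown it suffices that t takes the value 1 on
every sequence of indices with weights alpha_j - alpha_0 summing to 0 modulo
d.  A sequence of length at most d is padded with the index 0, of weight 0 and
value 1, to an invariant monomial of degree d.  In a longer one, two of the
first d + 1 partial sums agree modulo d; the stretch between them is a shorter
zero-sum sequence that can be split off. *)
Lemma torus_stabilizer (k : fieldType) (n d : nat) (e : k) (alpha : 'I_n.+1 -> nat)
    (t : 'I_n.+1 -> k) :
  [pchar k] =i pred0 -> d.-primitive_root e ->
  (forall j, alpha ord0 <= alpha j)%N -> t ord0 = 1 ->
  (forall a : 'X_{1..n.+1}, mdeg a = d -> \prod_j (e ^+ alpha j) ^+ a j = 1 ->
     \prod_j t j ^+ a j = 1) ->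
  exists w : 'I_d, forall j, t j = e ^+ (w * (alpha j - alpha ord0)).
Proof.
move=> k0 ep alpha0 t0 tP; have d0 := prim_order_gt0 ep.
pose g j := (alpha j - alpha ord0)%N.
have monE (x : 'I_n.+1 -> k) (s : seq 'I_n.+1) q :
    \prod_j x j ^+ (\sum_(l <- s) U_(l) + U_(ord0) *+ q)%MM j =
    \prod_(l <- s) x l * x ord0 ^+ q.
  rewrite -mevalX mpolyXD mevalM -mpolyXn rmorphXn /= mevalXU; congr (_ * _).
  by rewrite -mprodXE meval_prod; apply: eq_bigr => l _; rewrite mevalXU.
have short (s : seq 'I_n.+1) : (size s <= d)%N -> (d %| \sum_(l <- s) g l)%N ->
    \prod_(l <- s) t l = 1.
  move=> sd gs.
  pose a : 'X_{1..n.+1} := (\sum_(l <- s) U_(l) + U_(ord0) *+ (d - size s))%MM.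
  have := tP a; rewrite /a !monE t0 expr1n mulr1; apply.
    rewrite mdegD mdeg_sum mdegMn mdeg1 mul1n.
    by under eq_bigr do rewrite mdeg1; rewrite sum1_size subnKC.
  rewrite -exprM prodrXr -exprD.
  have -> : (\sum_(l <- s) alpha l + alpha ord0 * (d - size s) =
     \sum_(l <- s) g l + alpha ord0 * d)%N.
    rewrite -[in RHS](subnKC sd) mulnDr addnA; congr (_ + _)%N.
    rewrite -sum1_size big_distrr -big_split /=; apply: eq_bigr => l _.
    by rewrite muln1 subnK.
  by apply/eqP; rewrite -(prim_order_dvd ep) dvdn_add // dvdn_mull.
have seqP N : forall s : seq 'I_n.+1, (size s <= N)%N -> (d %| \sum_(l <- s) g l)%N ->
    \prod_(l <- s) t l = 1.
  elim: N => [|N IH] s sN gs.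
    by apply: short gs; move: sN; rewrite leqn0 => /eqP->.
  have [sd|sd] := leqP (size s) d; first exact: short.
  (* pigeonhole: two of these d + 1 partial sums agree modulo d *)
  pose f (i : 'I_d.+1) : 'I_d := Ordinal (ltn_pmod (\sum_(l <- take i s) g l) d0).
  have /injectivePn[i0 [j0 ij0 fij0]] : ~~ injectiveb f.
    by apply/negP => /injectiveP/leq_card; rewrite !card_ord ltnn.
  have [i [j [ij fij]]] : exists i j : 'I_d.+1, (i < j)%N /\ f i = f j.
    have := ij0; rewrite neq_ltn => /orP[h|h]; first by exists i0, j0.
    by exists j0, i0.
  have js : (j <= size s)%N by rewrite (leq_trans _ (ltnW sd)) // -ltnS.
  pose u := take i s; pose v := drop i (take j s); pose w := drop j s.
  have uvE : take j s = u ++ v by rewrite /u /v -(take_takel s (ltnW ij)) cat_take_drop.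
  have sE : s = u ++ v ++ w by rewrite catA -uvE cat_take_drop.
  have sv : size v = (j - i)%N by rewrite size_drop size_takel.
  have dv : (d %| \sum_(l <- v) g l)%N.
    have := congr1 val fij; rewrite /= uvE big_cat /= => /eqP.
    by rewrite -{1}[(\sum_(l <- _) g l)%N]addn0 eqn_modDl mod0n eq_sym.
  have v1 : \prod_(l <- v) t l = 1.
    by apply: short dv; rewrite sv (leq_trans (leq_subr _ _)) // -ltnS.
  have uw1 : \prod_(l <- u ++ w) t l = 1.
    apply: IH.
      rewrite -ltnS (leq_trans _ sN) // [in X in (_ < X)%N]sE !size_cat ltn_add2l.
      by rewrite -[X in (X < _)%N]add0n ltn_add2r sv subn_gt0.
    move: gs; rewrite {1}sE !big_cat /= [(\sum_(l <- v) _ + _)%N]addnC addnA.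
    by rewrite dvdn_addl.
  by rewrite sE !big_cat /= v1 mul1r -big_cat.
have [|w wP] := @root_unity_system k d e 'I_n.+1 unit (fun j _ => g j) t k0 ep.
  move=> f fd; pose s := flatten [seq nseq (f l) l | l <- enum 'I_n.+1].
  have -> : \prod_a t a ^+ f a = \prod_(l <- s) t l.
    rewrite big_flatten big_map big_enum /=; apply: eq_bigr => l _.
    by rewrite big_nseq -Monoid.iteropE.
  apply: (seqP (size s)) => //; have := fd tt; congr (_ %| _)%N.
  rewrite big_flatten big_map big_enum /=; apply: eq_bigr => l _.
  by rewrite big_nseq iter_addn_0 mulnC.
exists (w tt) => j; rewrite -wP (bigD1 tt) //= big1 ?mulr1 //.
Qed.

(** * Deck transformations of an invariant monomial map *)

(** Two representatives give the same point when the 2 x 2 minors vanish; this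
turns equality of points into polynomial equations. *)
Lemma is_point_minors (k : fieldType) (m : nat) (u v : 'rV[k]_m) (x y : proj k m) :
  is_point u x -> is_point v y ->
  (x = y <-> forall a b, u 0 a * v 0 b = u 0 b * v 0 a).
Proof.
move=> ux vy; split=> [xy|uv].
  have /is_pointP[c _ ->] := ux; have /is_pointP[c' _ ->] := vy.
  by move=> a b; rewrite xy !mxE mulrACA [coords _ _ a * _]mulrC mulrACA.
have [v0 _] := vy; have [u0 _] := ux.
have [b vb] := rV_neq0_ex v0.
have uE : u = (u 0 b / v 0 b) *: v.
  by apply/rowP => a; rewrite !mxE mulrAC -uv mulfK.
apply: (is_point_inj ux); rewrite uE; apply: is_point_scale vy.
by apply: contraNneq u0 => c0; rewrite uE c0 scale0r.
Qed.

Lemma diag_form_map_exists (k : fieldType) (n : nat) (c : 'I_n -> k) :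
  (forall j, c j != 0) ->
  exists f, form_map 1 (fun j => c j *: 'X_j : {mpoly k[n]}) f.
Proof.
move=> c0; apply: form_map_exists => [j|x].
  by apply: dhomogZ; rewrite dhomogX /= mdeg1.
have [j xj] := coords_neq0_ex x.
by exists j; rewrite /pval mevalZ mevalXU mulf_neq0.
Qed.

Lemma diag_form_mapP (k : fieldType) (n : nat) (c : 'I_n -> k) f :
  form_map 1 (fun j => c j *: 'X_j : {mpoly k[n]}) f ->
  forall x, is_point (\row_j (c j * coords x 0 j)) (f x).
Proof.
move=> [_ fP] x; have := fP x; congr is_point; apply/rowP => j.
by rewrite !mxE /pval mevalZ mevalXU.
Qed.

Lemma monomial_map_invariant (k : fieldType) (n r d : nat) (c : 'I_n -> k)
    (a : 'I_r -> 'X_{1..n}) phi f :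
  (forall i, mdeg (a i) = d) -> (forall i, \prod_j c j ^+ a i j = 1) ->
  form_map d (fun i => 'X_[a i] : {mpoly k[n]}) phi ->
  form_map 1 (fun j => c j *: 'X_j : {mpoly k[n]}) f ->
  forall x, phi (f x) = phi x.
Proof.
move=> ad ac phiF fF x; apply: is_point_inj (phiF.2 (f x)) _.
have [b b0 h] := pval_is_point (diag_form_mapP fF x).
suff -> : \row_i pval 'X_[a i] (f x) = (b ^+ d)^-1 *: \row_i pval 'X_[a i] x.
  by apply: is_point_scale (phiF.2 x); rewrite invr_eq0 expf_neq0.
apply/rowP => i; rewrite !mxE; apply: (mulfI (expf_neq0 d b0)).
have ha : ('X_[a i] : {mpoly k[n]}) \is d.-homog by rewrite dhomogX /= ad.
rewrite -(h _ _ ha) mulVKf ?expf_neq0 // /pval !mevalX.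
under [LHS]eq_bigr do rewrite mxE exprMn.
by rewrite big_split /= ac mul1r.
Qed.

(** The fibre over the image of a torus point y is an orbit of the cyclic group:
the ratios z_j / y_j give the same value to all invariant monomials of degree
d, in particular the value of the pure power x_0^d, so after division by
z_0 / y_0 they give the value 1. *)
Lemma torus_fibre (k : fieldType) (n r d : nat) (e : k) (alpha : 'I_n.+1 -> nat)
    (a : 'I_r -> 'X_{1..n.+1}) (v : 'I_n.+1 -> 'I_r) phi (y z : proj k n.+1) :
  [pchar k] =i pred0 -> d.-primitive_root e ->
  (forall j, alpha ord0 <= alpha j)%N ->
  (forall j, a (v j) = (U_(j) *+ d)%MM) ->
  (forall b : 'X_{1..n.+1}, mdeg b = d -> \prod_j (e ^+ alpha j) ^+ b j = 1 ->
     exists i, a i = b) ->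
  (forall i, mdeg (a i) = d) ->
  form_map d (fun i => 'X_[a i] : {mpoly k[n.+1]}) phi ->
  (forall j, coords y 0 j != 0) -> phi z = phi y ->
  exists w : 'I_d, is_point (\row_j ((e ^+ alpha j) ^+ w * coords y 0 j)) z.
Proof.
move=> k0 ep alpha0 av aP ad phiF y0 zy; have d0 := prim_order_gt0 ep.
have e0 : e != 0 := unity_neq0 d0 (prim_expr_order ep).
have [b b0 hz] := form_map_coords phiF z; have [c c0 hy] := form_map_coords phiF y.
pose t j := coords z 0 j / coords y 0 j.
have tP i : \prod_j t j ^+ a i j = b / c.
  under eq_bigr do rewrite expr_div_n.
  rewrite prodf_div -!mevalX -!/(pval _ _) hz hy zy -mulf_div divff ?mulr1 //.
  apply: contraTneq (expf_neq0 1 c0) => hi.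
  have : pval 'X_[a i] y != 0.
    by rewrite /pval mevalX; apply/prodf_neq0 => j _; rewrite expf_neq0.
  by rewrite hy hi mulr0 eqxx.
have td : t ord0 ^+ d = b / c.
  rewrite -(tP (v ord0)) -mevalX av -mpolyXn rmorphXn /=.
  by rewrite mevalXU.
have bc0 : b / c != 0 by rewrite mulf_neq0 ?invr_eq0.
have t0 : t ord0 != 0.
  by apply: contraNneq bc0 => t0; rewrite -td t0 expr0n gtn_eqF.
have [||w wP] := @torus_stabilizer k n d e alpha (fun j => t j / t ord0) k0 ep alpha0.
- by rewrite divff.
- move=> s sd sM; have [i <-] := aP _ sd sM.
  under eq_bigr do rewrite expr_div_n.
  by rewrite prodf_div tP prodrXr -mdegE ad td divff.
exists w; apply/is_pointP.
exists ((e ^+ alpha ord0) ^+ w / t ord0).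
  by rewrite mulf_neq0 ?invr_eq0 // !expf_neq0.
apply/rowP => j; rewrite !mxE.
have -> : coords z 0 j = t j / t ord0 * t ord0 * coords y 0 j.
  by rewrite divfK // /t divfK.
rewrite wP mulrA; congr (_ * _); rewrite [_ * t ord0]mulrC mulrA divfK //.
by rewrite mulnC exprM -exprMn -exprD subnKC.
Qed.

(** If g differed from each of the maps psi_w at some point, the locus where g and
psi_w differ would contain a nonempty basic open set for each w.  The product
of the finitely many forms involved does not vanish at some torus point, where
g differs from all psi_w, contrary to the description of the fibres. *)
Lemma deck_is_diag (k : fieldType) (n r d : nat) (phi : proj k n.+1 -> proj k r)
    (c : 'I_d -> 'I_n.+1 -> k) (psi : 'I_d -> proj k n.+1 -> proj k n.+1) g :
  [pchar k] =i pred0 ->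
  (forall w, form_map 1 (fun j => c w j *: 'X_j : {mpoly k[n.+1]}) (psi w)) ->
  (forall y z, (forall j, coords y 0 j != 0) -> phi z = phi y ->
     exists w, z = psi w y) ->
  deck setT phi g -> exists w, forall y, g y = psi w y.
Proof.
move=> k0 psiF fib [[[_ gm] _] gphi].
apply: contrapT => /forallNP no.
have /boolp.choice[Q QP] : forall w, exists Q : nat * {mpoly k[n.+1]},
    [/\ Q.2 \is Q.1.-homog, Q.2 != 0 & forall z, pval Q.2 z != 0 -> g z <> psi w z].
  move=> w; have /existsNP[y gy] := no w.
  have [E [G [U [Gh Uo Uy GU]]]] := gm y I.
  have [e' [s [se sy sU]]] := zariski_open_basic Uo Uy.
  have psiP := diag_form_mapP (psiF w).
  have [a [b ab]] : exists a b, pval (G a) y * (c w b * coords y 0 b) !=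
      pval (G b) y * (c w a * coords y 0 a).
    apply: contrapT => nab; apply: gy.
    apply/(is_point_minors (GU y I Uy) (psiP y)) => a b; rewrite !mxE.
    apply: contrapT => /eqP h; apply: nab; by exists a, b.
  (* a minor that is nonzero at y; where it does not vanish, g and psi_w differ *)
  pose Nm := G a * (c w b *: 'X_b) - G b * (c w a *: 'X_a).
  have NmE z : pval Nm z = pval (G a) z * (c w b * coords z 0 b) -
      pval (G b) z * (c w a * coords z 0 a).
    by rewrite /pval mevalB !mevalM !mevalZ !mevalXU.
  have Nmh : Nm \is (E + 1).-homog.
    have [ch _] := psiF w.
    by apply: rpredB; apply: dhomogM.
  exists ((E + 1 + e')%N, Nm * s); split=> /=.
  - exact: dhomogM.
  - suff : pval (Nm * s) y != 0 by apply: contraNneq => ->; rewrite /pval meval0.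
    by rewrite /pval mevalM mulf_neq0 // -/(pval _ _) NmE subr_eq0.
  move=> z; rewrite /pval mevalM mulf_eq0 negb_or => /andP[+ sz].
  rewrite -/(pval _ _) NmE subr_eq0 => /eqP Nz gz; apply: Nz.
  have := (is_point_minors (GU z I (sU _ sz)) (psiP z)).1 gz a b.
  by rewrite !mxE.
have Qh w : (Q w).2 \is (Q w).1.-homog by case: (QP w).
have [|z [Qz z0]] := torus_nonvanishing k0 (dhomog_prodf (index_enum 'I_d) Qh).
  by apply/prodf_neq0 => w _; case: (QP w).
have [w gz] := fib _ _ z0 (gphi z I).
have [_ _ /(_ z)] := QP w; apply=> //.
by move: Qz; rewrite /pval meval_prod => /prodf_neq0/(_ w isT).
Qed.

Lemma form_map_id (k : fieldType) (n : nat) :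
  form_map 1 (fun j => 'X_j : {mpoly k[n]}) id.
Proof.
split=> [j|x]; first by rewrite dhomogX /= mdeg1.
rewrite (_ : \row_j _ = coords x); first exact: is_point_coords.
by apply/rowP => j; rewrite mxE pvalX.
Qed.

(** The coordinates of phi(y) at the pure powers show which coordinates of y
vanish, so the point [1 : 0 : ... : 0] is alone in its fibre. *)
Lemma pure_power_fibre (k : fieldType) (n r d : nat) (a : 'I_r -> 'X_{1..n.+1})
    (v : 'I_n.+1 -> 'I_r) phi (p y : proj k n.+1) :
  (0 < d)%N -> (forall j, a (v j) = (U_(j) *+ d)%MM) ->
  form_map d (fun i => 'X_[a i] : {mpoly k[n.+1]}) phi ->
  is_point (\row_j (j == ord0)%:R) p -> phi y = phi p -> y = p.
Proof.
move=> d0 av phiF pP yp; have /is_pointP[c c0 /rowP hp] := pP.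
have zero j : j != ord0 -> coords y 0 j = 0.
  move=> j0; have [b b0 hy] := form_map_coords phiF y.
  have [b' b'0 hp'] := form_map_coords phiF p.
  have : coords y 0 j ^+ d = 0.
    have pj : coords p 0 j = 0.
      have /eqP := hp j; rewrite !mxE (negbTE j0) eq_sym mulf_eq0 (negbTE c0).
      by move/eqP.
    have := hp' (v j); rewrite av pval_pure_power pj expr0n gtn_eqF // => /esym/eqP.
    rewrite mulf_eq0 (negbTE b'0) /= => /eqP h.
    by have := hy (v j); rewrite av pval_pure_power yp h mulr0.
  by move/eqP; rewrite expf_eq0 d0 => /eqP.
have yE : coords y = coords y 0 ord0 *: \row_j (j == ord0)%:R.
  apply/rowP => j; rewrite !mxE; have [->|/zero->] := eqVneq j ord0.
    by rewrite mulr1.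
  by rewrite mulr0.
apply: (is_point_inj (is_point_coords y)); rewrite yE; apply: is_point_scale pP.
have := coords_neq0 y; apply: contraNneq => h.
by rewrite yE h scale0r.
Qed.

(** The psi_i for i in Z are the maps diag(c)^i; they are deck transformations,
exhaust Aut(phi) by [deck_is_diag], and psi_i is the identity exactly when
diag(c)^i is scalar. *)
Lemma deck_group_diag (k : fieldType) (n r d : nat) (phi : proj k n.+1 -> proj k r)
    (c : 'I_n.+1 -> k) :
  [pchar k] =i pred0 -> (forall j, c j != 0) -> (forall j, c j ^+ d = 1) ->
  (forall (i : int) lam, (forall j, c j ^ i = lam) -> (d %| i)%Z) ->
  (forall (i : int) f, form_map 1 (fun j => (c j ^ i) *: 'X_j : {mpoly k[n.+1]}) f ->
     forall y, phi (f y) = phi y) ->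
  (forall y z, (forall j, coords y 0 j != 0) -> phi z = phi y ->
     exists w : 'I_d, is_point (\row_j (c j ^+ w * coords y 0 j)) z) ->
  deck_group_Zmod setT phi d.
Proof.
move=> k0 c0 cd cker phic fib.
have /boolp.choice[psi psiF] : forall i : int, exists f,
    form_map 1 (fun j => (c j ^ i) *: 'X_j : {mpoly k[n.+1]}) f.
  by move=> i; apply: diag_form_map_exists => j; rewrite expfz_neq0.
have psiP i := diag_form_mapP (psiF i).
have psiD i j y : psi (i + j) y = psi i (psi j y).
  have /is_pointP[b b0 /rowP hb] := psiP j y.
  apply: (is_point_inj (psiP _ _)).
  rewrite (_ : \row_l _ = b *: \row_l (c l ^ i * coords (psi j y) 0 l)).
    exact: is_point_scale (psiP _ _).
  apply/rowP => l; have := hb l; rewrite !mxE expfzDr // -mulrA => ->.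
  by rewrite mulrCA.
have psi1 i : (d %| i)%Z -> forall y, psi i y = y.
  move=> /dvdzP[q ->] y; apply: is_point_inj (is_point_coords y).
  have := psiP (q * d)%R y; congr is_point; apply/rowP => j.
  by rewrite mxE [(q * _)%R]mulrC -exprz_exp (_ : c j ^ d = 1) ?exp1rz ?mul1r //; apply: cd.
have psiK i y : psi (- i) (psi i y) = y.
  by rewrite -psiD addNr psi1.
exists psi; split.
- move=> i; split; last by move=> y _; apply: phic (psiF i) y.
  split; first exact: form_map_morphism (psiF i) _.
  exists (psi (- i)); split=> [|y _|y _].
  + exact: form_map_morphism (psiF (- i)) _.
  + exact: psiK.
  by rewrite -{1}[i]opprK psiK.
- by move=> i j y _; apply: psiD.
- move=> g gd; have [|w gE] := @deck_is_diag k n r d phi (fun w j => c j ^ (w : int))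
    (fun w => psi w) g k0 (fun w => psiF w) _ gd.
    move=> y z y0 /(fib _ _ y0)[w wP]; exists w; apply: (is_point_inj wP).
    exact: (psiP (w : nat) y).
  by exists w => y _; apply: gE.
move=> i; split=> [h|/psi1 h y _]; last exact: h.
have one0 : \row_(j < n.+1) (1 : k) != 0.
  by apply/negP => /eqP/rowP/(_ ord0)/eqP; rewrite !mxE oner_eq0.
have [y yP] := is_point_exists one0.
have /is_pointP[b b0 /rowP hb] := yP.
have := psiP i y; rewrite h // => /is_pointP[b' b'0 /rowP hb'].
apply: (cker i b') => j; have y0 : coords y 0 j != 0.
  by have := hb j; rewrite !mxE; apply: contra_eq_neq => ->; rewrite mulr0 oner_eq0.
by have := hb' j; rewrite !mxE => /(mulIf y0).
Qed.

(** * The theorem *)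

Theorem corollary3p4 (k : closedFieldType) (char0 : [pchar k] =i pred0)
    (n d : nat) (n_ge2 : (2 <= n)%N) (n_lt_d : (n < d)%N)
    (alpha : 'I_n.+1 -> nat)
    (alpha_mono : forall i j : 'I_n.+1, (i <= j)%N -> (alpha i <= alpha j)%N)
    (alpha_lt_d : forall i, (alpha i < d)%N)
    (alpha_gcd : gcdn (\big[gcdn/0%N]_(i < n.+1) alpha i) d = 1%N)
    (e : k) (e_prim : d.-primitive_root e)
    (M : 'M[k]_n.+1) (M_def : M = diag_mx (\row_i e ^+ alpha i))
    (Lambda : set 'M[k]_n.+1) (Lambda_def : Lambda = GL_generated [set M])
    (Lambdabar : set 'M[k]_n.+1)
    (Lambdabar_def : Lambdabar = GL_generated [set M; e%:M])
    (Lambdabar_order : has_order Lambdabar (d ^ 2)%N)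
    (mu : nat) (m : 'I_mu -> 'X_{1..n.+1}) (m_inj : injective m)
    (m_spec : forall a : 'X_{1..n.+1},
       (exists i, m i = a) <->
       mdeg a = d /\ diag_invariant Lambda ('X_[a] : {mpoly k[n.+1]}))
    (mu_le : (mu <= 'C(n + d - 1, n - 1))%N) :
  monomial_GT_system d (ideal_gen (fun i => 'X_[m i] : {mpoly k[n.+1]})).
Proof.
have d0 := prim_order_gt0 e_prim.
have n0 : (0 < n)%N by apply: leq_trans n_ge2.
pose c j := e ^+ alpha j.
have cd j : c j ^+ d = 1 by rewrite /c exprAC (prim_expr_order e_prim) expr1n.
have c0 j : c j != 0 := unity_neq0 d0 (cd j).
have invP (a : 'X_{1..n.+1}) :
    diag_invariant Lambda ('X_[a] : {mpoly k[n.+1]}) <-> \prod_j c j ^+ a j = 1.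
  rewrite Lambda_def M_def; split=> [inv|ca b].
    have := congr1 (mcoeff a) (inv _ (GL_generated_in (erefl _))).
    rewrite mcoeff_diag_act mcoeffX eqxx mulr1 => h.
    by rewrite -[RHS]/(true%:R) -h; apply: eq_bigr => j _; rewrite mxE.
  case/(GL_generated_diag (d := d) (R := [set b | exists i : nat,
      forall j, b j = c j ^+ i])) => //.
  - by move=> B ->; exists c => //; exists 1%N.
  - by exists 0%N.
  - move=> b1 b2 [i1 E1] [i2 E2]; exists (i1 + i2)%N => j.
    by rewrite E1 E2 exprD.
  - by move=> b1 j [i ->]; rewrite exprAC cd expr1n.
  move=> b1 [i bE] /matrixP bb; apply/mpolyP => a'.
  rewrite mcoeff_diag_act mcoeffX; have [<-|_] := eqVneq a a'; last by rewrite mulr0.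
  have -> : \prod_j b 0 j ^+ a j = (\prod_j c j ^+ a j) ^+ i.
    rewrite -prodrXl; apply: eq_bigr => j _.
    by have := bb j j; rewrite !mxE eqxx !mulr1n bE => ->; rewrite exprAC.
  by rewrite ca expr1n mul1r.
have mdegm i : mdeg (m i) = d by case: ((m_spec (m i)).1 (ex_intro _ i erefl)).
have minv i : \prod_j c j ^+ m i j = 1.
  by apply/invP; case: ((m_spec (m i)).1 (ex_intro _ i erefl)).
have mP (a : 'X_{1..n.+1}) : mdeg a = d -> \prod_j c j ^+ a j = 1 ->
    exists i, m i = a.
  by move=> ad /invP ainv; apply/m_spec.
have /boolp.choice[v vP] : forall j, exists i, m i = (U_(j) *+ d)%MM.
  move=> j; apply: mP; first by rewrite mdegMn mdeg1 mul1n.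
  rewrite -mevalX -mpolyXn rmorphXn /= mevalXU; exact: cd.
case: mu m m_inj m_spec mu_le mdegm minv mP v vP => [|r] m m_inj m_spec mu_le mdegm
    minv mP v vP; first by case: (v ord0).
split; last by exists r.+1, m.
exists r.+1, (fun i => 'X_[m i]).
have homF i : ('X_[m i] : {mpoly k[n.+1]}) \is d.-homog by rewrite dhomogX /= mdegm.
split=> //.
  split=> //; first exact: artinian_monomial vP.
  apply: fails_WLP_dim => //.
  exact: norm_kernel cd mP.
have [|phi phiF] := form_map_exists homF.
  move=> x; have [j xj] := coords_neq0_ex x.
  by exists (v j); rewrite vP pval_pure_power expf_neq0.
have rclosed := monomial_map_closed char0 e_prim vP mdegm phiF.
have alpha0 j : (alpha ord0 <= alpha j)%N by apply: alpha_mono.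
exists phi; split; first exact: phiF.2.
  split.
    split.
    - split; last exact: irreducible_proj.
      by exists setT, setT; split; [apply: zariski_closedT|apply: zariski_openT|rewrite setIT].
    - split; last exact: irreducible_range phiF (irreducible_proj _ char0).
      by exists (range phi), setT; split; [ |apply: zariski_openT|rewrite setIT].
    exact: monomial_map_finite char0 d0 vP phiF rclosed.
  have p0 : \row_(j < n.+1) (j == ord0)%:R != 0 :> 'rV[k]_n.+1.
    by apply/negP => /eqP/rowP/(_ ord0)/eqP; rewrite !mxE eqxx oner_eq0.
  have [p pP] := is_point_exists p0.
  exists (phi p) => [|y z _ _ yp zp]; first by exists p.
  exists id; last first.
    by rewrite (pure_power_fibre d0 vP phiF pP yp) (pure_power_fibre d0 vP phiF pP zp).
  split=> //; split; first exact: form_map_morphism (form_map_id _ _) _.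
  by exists id; split=> //; apply: form_map_morphism (form_map_id _ _) _.
apply: (deck_group_diag char0 c0 cd).
- move=> i lam clam; rewrite /dvdz /=.
  have ci : exists lam', forall j, c j ^+ `|i| = lam'.
    case: i clam => i h; first by exists lam => j; apply: h.
    by exists lam^-1 => j; rewrite -(h j) invrK.
  have [lam' ci'] := ci; apply: (scalar_power_dvd e_prim cd _ _ ci') => //.
  by rewrite -[X in has_order (GL_generated [set X; _])]M_def -Lambdabar_def.
- move=> i f fF y; apply: (monomial_map_invariant mdegm _ phiF fF) => l.
  under eq_bigr do rewrite exprnP exprzAC -exprnP.
  have expM : {morph (fun x : k => x ^ i) : x y / x * y}.
    by move=> x x'; apply: expfzMl.
  by rewrite -(big_morph _ expM (exp1rz _ _)) minv exp1rz.
move=> y z y0 zy.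
exact: torus_fibre char0 e_prim alpha0 vP mP mdegm phiF y0 zy.
Qed.
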